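(* Let $n$ be a positive integer, let $m,t$ be positive divisors of $n$ with $n\nmid mt$, let $\zeta\in\Bbbk$ be a primitive $n$-th root of unity, let $N=\operatorname{ord}(\zeta^{mt})$, and let $H=H_n(\zeta,m,t)$. There exist $H$-module algebra structures $A(H)$ if and only if one of the following equivalent conditions holds: (a) $\gcd(t,n/m)=1$; (b) $\gcd(mt,n)=m$; (c) $n/m=N$. In particular, if $t=1$, then such $H$-module algebra structures $A(H)$ exist. On the other hand, if such structures exist, then $t\mid m$, and in this case the module structure is given by $$y\cdot u=\zeta u,\qquad x\cdot u=\gamma u^{t+1}$$ for some nonzero $\gamma\in\Bbbk$, where $A(H)=\Bbbk[u]/(u^n-1)$ and the generator $u$ is chosen so that $y\cdot u=\zeta u$.
   Context: $\Bbbk$ is an algebraically closed field of characteristic $0$. For grouplike elements $g,h$, an element $c$ is $(g,h)$-skew primitive if $\Delta(c)=g\otimes c+c\otimes h$. $H_n(\zeta,m,t)$ is the Hopf algebra generated as a $\Bbbk$-algebra by $y,x$ subject to $y^n=1$, $x^N=0$ (where $N=\operatorname{ord}(\zeta^{mt})$) and $yx=\zeta^t xy$, with $y$ grouplike and $x$ being $(y^m,1)$-skew primitive. Its group of grouplike elements is $\langle y\rangle$, cyclic of order $n$. An $H$-module algebra is an algebra $A$ that is a left $H$-module with $h\cdot(ab)=(h_{(1)}\cdot a)(h_{(2)}\cdot b)$ and $h\cdot 1_A=\epsilon(h)1_A$. The action is inner-faithful if $I\cdot A\neq 0$ for every nonzero Hopf ideal $I$ of $H$. Notation $A(H)$: for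 a Hopf algebra $H$ whose group $G$ of grouplike elements is finite abelian, $A(H)$ denotes an inner-faithful $H$-module algebra that is isomorphic to $\Bbbk G$ as an algebra, on which $\Bbbk G\subset H$ acts through an identification $G\cong\widehat G$ (character group), $\widehat G$ acting on $\Bbbk G$ by $\chi\cdot h=\langle\chi,h\rangle h$ for $h\in G$. When $G=\langle y\rangle$ is cyclic of order $n$ and $\zeta$ is a fixed primitive $n$-th root of unity, this means $A(H)=\Bbbk[u]/(u^n-1)$ as an algebra, where $u$ can be chosen with $y\cdot u=\zeta u$. *)

(* Defs.v *)
From HB Require Import structures.
From mathcomp Require Import all_boot all_order all_algebra all_fingroup.
From mathcomp Require Import boolp.

Set Implicit Arguments.
Unset Strict Implicit.
Unset Printing Implicit Defensive.

Import GRing.Theory.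
Local Open Scope ring_scope.
Local Open Scope quotient_scope.

(** * Tensor product of vector spaces *)

(* [tens V W] is the type of formal sums of pairs, where two formal sums are
   identified when no bilinear map distinguishes them. *)

Section Tensor.
Variables (k : fieldType) (V W : lmodType k).

Definition is_bilinear (U : lmodType k) (b : V -> W -> U) : Prop :=
  bilinear_for *:%R *:%R b.

Definition fsum (U : lmodType k) (b : V -> W -> U) (s : seq (V * W)) : U :=
  \sum_(p <- s) b p.1 p.2.

Definition tens_rel : rel (seq (V * W)) := fun s s' =>
  `[< forall (U : lmodType k) (b : V -> W -> U),
        is_bilinear b -> fsum b s = fsum b s' >].

Lemma tens_rel_refl : reflexive tens_rel.
Proof. by move=> s; apply/asboolP. Qed.

Lemma tens_rel_sym : symmetric tens_rel.
Proof. by move=> s s'; apply/asboolP/asboolP => h U b hb; rewrite h. Qed.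

Lemma tens_rel_trans : transitive tens_rel.
Proof.
move=> s2 s1 s3 /asboolP h1 /asboolP h2.
by apply/asboolP => U b hb; rewrite h1 ?h2.
Qed.

Canonical tens_equiv :=
  EquivRel tens_rel tens_rel_refl tens_rel_sym tens_rel_trans.

Definition tens : Type := {eq_quot tens_equiv}.
HB.instance Definition _ := Choice.copy tens {eq_quot tens_equiv}.

Definition tens_of (s : seq (V * W)) : tens := \pi_({eq_quot tens_equiv}) s.
Definition tens_repr (z : tens) : seq (V * W) :=
  generic_quotient.repr (z : {eq_quot tens_equiv}).

Definition tpure (v : V) (w : W) : tens := tens_of [:: (v, w)].

(* [\tsum_(a, b <- z) E], for [E] bilinear in [(a, b)], is the value at [z] of
   the induced linear map on the tensor product (see [tsum_tens_of]); applied to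
   a coproduct it is Sweedler's summation. *)
Definition tsum (U : lmodType k) (z : tens) (b : V -> W -> U) : U :=
  fsum b (tens_repr z).

Lemma tens_reprK z : tens_of (tens_repr z) = z.
Proof. exact: (@reprK _ {eq_quot tens_equiv}). Qed.

Lemma tens_ofP s s' :
  (forall (U : lmodType k) (b : V -> W -> U),
      is_bilinear b -> fsum b s = fsum b s') <-> tens_of s = tens_of s'.
Proof.
split=> [h|/(@eqmodP _ tens_equiv) /asboolP //].
by apply/(@eqmodP _ tens_equiv)/asboolP.
Qed.

Lemma tsum_tens_of (U : lmodType k) (b : V -> W -> U) s :
  is_bilinear b -> tsum (tens_of s) b = fsum b s.
Proof. by move=> hb; apply: (tens_ofP _ _).2 hb; rewrite tens_reprK. Qed.

Lemma tens_eqP z z' :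
  (forall (U : lmodType k) (b : V -> W -> U),
      is_bilinear b -> tsum z b = tsum z' b) -> z = z'.
Proof. by move=> h; rewrite -(tens_reprK z) -(tens_reprK z'); apply/tens_ofP. Qed.

Definition tens_add (z z' : tens) : tens :=
  tens_of (tens_repr z ++ tens_repr z').
Definition tens_scale (a : k) (z : tens) : tens :=
  tens_of [seq (a *: p.1, p.2) | p <- tens_repr z].
Definition tens_opp (z : tens) : tens := tens_scale (-1) z.

Section Tsum.
Variables (U : lmodType k) (b : V -> W -> U) (hb : is_bilinear b).

Lemma tsum0 : tsum (tens_of [::]) b = 0.
Proof. by rewrite tsum_tens_of // /fsum big_nil. Qed.

Lemma tsum_add z z' : tsum (tens_add z z') b = tsum z b + tsum z' b.
Proof. by rewrite tsum_tens_of // /fsum big_cat. Qed.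

Lemma tsum_scale a z : tsum (tens_scale a z) b = a *: tsum z b.
Proof.
rewrite tsum_tens_of // /tsum /fsum big_map scaler_sumr.
by apply: eq_bigr => p _ /=; rewrite (scalable_linear (hb.1 p.2)).
Qed.

Lemma tsum_pure v w : tsum (tpure v w) b = b v w.
Proof. by rewrite tsum_tens_of // /fsum big_seq1. Qed.

End Tsum.

Fact tens_addA : associative tens_add.
Proof. by move=> x y z; apply: tens_eqP => U b hb; rewrite !tsum_add // addrA. Qed.
Fact tens_addC : commutative tens_add.
Proof. by move=> x y; apply: tens_eqP => U b hb; rewrite !tsum_add // addrC. Qed.
Fact tens_add0 : left_id (tens_of [::]) tens_add.
Proof.
by move=> x; apply: tens_eqP => U b hb; rewrite tsum_add // tsum0 // add0r.
Qed.
Fact tens_addN : left_inverse (tens_of [::]) tens_opp tens_add.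
Proof.
move=> x; apply: tens_eqP => U b hb.
by rewrite tsum_add // tsum_scale // tsum0 // scaleN1r addNr.
Qed.

HB.instance Definition _ :=
  GRing.isZmodule.Build tens tens_addA tens_addC tens_add0 tens_addN.

Fact tens_scaleA a a' z :
  tens_scale a (tens_scale a' z) = tens_scale (a * a') z.
Proof. by apply: tens_eqP => U b hb; rewrite !tsum_scale // scalerA. Qed.
Fact tens_scale1 : left_id 1 tens_scale.
Proof. by move=> z; apply: tens_eqP => U b hb; rewrite tsum_scale // scale1r. Qed.
Fact tens_scaleDr : right_distributive tens_scale +%R.
Proof.
move=> a z z'; apply: tens_eqP => U b hb.
by rewrite tsum_scale // !tsum_add // !tsum_scale // scalerDr.
Qed.
Fact tens_scaleDl z : {morph tens_scale^~ z : a a' / a + a'}.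
Proof.
move=> a a'; apply: tens_eqP => U b hb.
by rewrite tsum_add // !tsum_scale // scalerDl.
Qed.

HB.instance Definition _ := GRing.Zmodule_isLmodule.Build k tens
  tens_scaleA tens_scale1 tens_scaleDr tens_scaleDl.

Lemma tsum_linear (U : lmodType k) (b : V -> W -> U) :
  is_bilinear b -> linear (fun z => tsum z b).
Proof.
by move=> hb a z z'; rewrite -tsum_scale // -tsum_add.
Qed.

Lemma tpure_bilinear : is_bilinear tpure.
Proof.
split=> [w a v v'|v a w w']; apply: tens_eqP => U b hb;
  rewrite tsum_linear // !tsum_pure //.
  exact: hb.1.
exact: hb.2.
Qed.

Lemma tensE z : z = tsum z tpure.
Proof.
apply: tens_eqP => U b hb.
suff hs s : tsum (fsum tpure s) b = fsum b s by exact: esym (hs (tens_repr z)).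
elim: s => [|p s ihs]; first by rewrite /fsum !big_nil [LHS]tsum0.
by rewrite /fsum !big_cons [LHS]tsum_add // ihs tsum_pure.
Qed.

(* the image of P (x) Q in V (x) W *)
Definition tens_sub (P : V -> Prop) (Q : W -> Prop) (z : tens) : Prop :=
  exists s : seq (V * W),
    (forall p, p \in s -> P p.1 /\ Q p.2) /\ z = \sum_(p <- s) tpure p.1 p.2.

End Tensor.

Notation "\tsum_ ( a , b <- z ) E" := (tsum z (fun a b => E))
  (at level 36, a name, b name, z at level 36, E at level 36,
   format "\tsum_ ( a ,  b  <-  z )  E") : ring_scope.
Notation "v \ot w" := (tpure v w) (at level 40, left associativity) : ring_scope.

Definition tens_mul (k : fieldType) (A B : algType k) (z z' : tens A B) :
    tens A B :=
  \tsum_(a, b <- z) \tsum_(c, d <- z') ((a * c) \ot (b * d)).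

(** * Hopf algebras *)

Record hopfAlgebra (k : fieldType) := HopfAlgebra {
  hopf_sort :> algType k;
  comul : {linear hopf_sort -> tens hopf_sort hopf_sort};
  counit : {lrmorphism hopf_sort -> k | *%R};
  antipode : {linear hopf_sort -> hopf_sort};
  comul1 : comul 1 = 1 \ot 1;
  comulM : forall g h, comul (g * h) = tens_mul (comul g) (comul h);
  comulA : forall h,
    \tsum_(a, b <- comul h) (\tsum_(a1, a2 <- comul a) (a1 \ot (a2 \ot b))) =
    \tsum_(a, b <- comul h) (a \ot comul b);
  counitl : forall h, \tsum_(a, b <- comul h) (counit a *: b) = h;
  counitr : forall h, \tsum_(a, b <- comul h) (counit b *: a) = h;
  antipodel : forall h, \tsum_(a, b <- comul h) (antipode a * b) = (counit h)%:A;
  antipoder : forall h, \tsum_(a, b <- comul h) (a * antipode b) = (counit h)%:A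
}.

Arguments comul {k _}.
Arguments counit {k _}.
Arguments antipode {k _}.

Section HopfTheory.
Variables (k : fieldType) (H : hopfAlgebra k).

Definition grouplike (g : H) : Prop := g != 0 /\ comul g = g \ot g.

Definition skew_primitive (g h c : H) : Prop :=
  comul c = g \ot c + c \ot h.

Record hopf_ideal (I : H -> Prop) : Prop := HopfIdeal {
  hopf_ideal0 : I 0;
  hopf_idealD : forall a b, I a -> I b -> I (a + b);
  hopf_idealMl : forall a b, I b -> I (a * b);
  hopf_idealMr : forall a b, I a -> I (a * b);
  hopf_ideal_comul : forall a, I a -> exists z z' : tens H H,
    [/\ tens_sub I (fun=> True) z, tens_sub (fun=> True) I z'
      & comul a = z + z'];
  hopf_ideal_counit : forall a, I a -> counit a = 0;
  hopf_ideal_antipode : forall a, I a -> I (antipode a)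
}.

Variable A : algType k.

Record module_algebra (act : H -> A -> A) : Prop := ModuleAlgebra {
  act_bilinear : is_bilinear act;
  act_one : forall a, act 1 a = a;
  act_mul : forall g h a, act (g * h) a = act g (act h a);
  actM : forall h a b,
    act h (a * b) = \tsum_(h1, h2 <- comul h) (act h1 a * act h2 b);
  act1 : forall h, act h 1 = (counit h)%:A
}.

Definition inner_faithful (act : H -> A -> A) : Prop :=
  forall I : H -> Prop, hopf_ideal I -> (exists2 h, I h & h != 0) ->
    exists h a, I h /\ act h a != 0.

(* linear characters of G with values in k *)
Definition kchar (G : finGroupType) (chi : G -> k) : Prop :=
  chi 1%g = 1 /\ forall g h, chi (g * h)%g = chi g * chi h.

(* [iota] identifies the finite abelian group [G] with the grouplike elements
   of [H], [e] is the image of the canonical basis of the group algebra under an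
   algebra isomorphism from it to [A], and [Phi] is an isomorphism from [G] to
   its character group. *)
Definition is_AH (act : H -> A -> A) : Prop :=
  [/\ module_algebra act, inner_faithful act &
   exists (G : finGroupType) (iota : G -> H) (e : G -> A) (Phi : G -> G -> k),
   [/\ abelian [set: G],
       [/\ injective iota, iota 1%g = 1,
           forall g h, iota (g * h)%g = iota g * iota h
         & forall a, grouplike a <-> exists g, a = iota g],
       [/\ e 1%g = 1, forall g h, e (g * h)%g = e g * e h
         & forall a, exists! c : {ffun G -> k}, a = \sum_g c g *: e g],
       [/\ forall g, kchar (Phi g),
           forall g g' h, Phi (g * g')%g h = Phi g h * Phi g' h
         & forall chi, kchar chi -> exists! g, Phi g =1 chi]
     & forall g h, act (iota g) (e h) = Phi g h *: e h]].

(* A = k[u]/(u^n - 1) *)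
Definition cyclic_generator (n : nat) (u : A) : Prop :=
  (forall a : A, exists p : {poly k}, a = horner_alg u p) /\
  (forall p : {poly k}, horner_alg u p = 0 <-> ('X^n - 1) %| p).

End HopfTheory.

(** * The Hopf algebras H_n(zeta, m, t) *)

Definition Hn_rel (k : fieldType) (n t N : nat) (zeta : k) (B : algType k)
    (y x : B) : Prop :=
  [/\ y ^+ n = 1, x ^+ N = 0 & y * x = zeta ^+ t *: (x * y)].

(* [H] is H_n(zeta, m, t) with its generators [y] and [x], where [N] is the
   order of [zeta ^+ (m * t)]; [Hn_univ] says that every relation between [y]
   and [x] follows from [Hn_rel]. *)
Record is_Hn (k : fieldType) (n m t N : nat) (zeta : k) (H : hopfAlgebra k)
    (y x : H) : Prop := IsHn {
  Hn_relP : Hn_rel n t N zeta y x;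
  Hn_gen : forall S : H -> Prop,
    S 1 -> (forall a b, S a -> S b -> S (a + b)) ->
    (forall (c : k) a, S a -> S (c *: a)) ->
    (forall a b, S a -> S b -> S (a * b)) ->
    S y -> S x -> forall h, S h;
  Hn_univ : forall (B : algType k) (y' x' : B), Hn_rel n t N zeta y' x' ->
    exists f : {lrmorphism H -> B}, f y = y' /\ f x = x';
  Hn_grouplike : grouplike y;
  Hn_skew : skew_primitive (y ^+ m) 1 x
}.

(* Main.v *)
Require Import Defs.
From HB Require Import structures.
From mathcomp Require Import all_boot all_order all_algebra all_fingroup.
From mathcomp Require Import boolp.

Set Implicit Arguments.
Unset Strict Implicit.
Unset Printing Implicit Defensive.

Import GRing.Theory.
Local Open Scope ring_scope.

(** If [u] generates an [A(H)], then [x . u] lies in the line of [u ^ (t + 1)],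
    say [x . u = gamma u ^ (t + 1)], so that [x . u ^ i] is
    [gamma (1 + q + ... + q ^ (i - 1)) u ^ (i + t)] with [q = zeta ^ m].
    If [gamma = 0] then the Hopf ideal [H x] kills [A]; otherwise
    [x ^ N . u = 0] forces [n / m] to divide some [1 + t l].  That [A(H)] is
    [k[u]/(u^n - 1)] rests on the grouplikes of [H] being the powers of [y].

    Conversely, on the functions on [Z/n], let [y] be the shift and
    [x . a = u ^ t (y ^ m . a - a)], where [u i = zeta ^ i].

    Both the determination of the grouplikes and inner-faithfulness use the
    operators [h |-> sum phi(h_1) h_2]: they multiply a grouplike by a scalar
    and preserve every Hopf ideal on which [phi] vanishes, and for suitable matrix
    coefficients [phi] they lower the degree in [x]. *)

(** * Linearity and multiplicativity of sums over tensors *)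

Section Tsum.
Variables (k : fieldType).

Section Two.
Variables (V W : lmodType k).
Implicit Types (z : tens V W).

Lemma tsumD (U : lmodType k) (b : V -> W -> U) z z' :
  is_bilinear b -> tsum (z + z') b = tsum z b + tsum z' b.
Proof. by move=> hb; apply: (tsum_add hb z z'). Qed.

Lemma tsumZ (U : lmodType k) (b : V -> W -> U) a z :
  is_bilinear b -> tsum (a *: z) b = a *: tsum z b.
Proof. by move=> hb; apply: (tsum_scale hb a z). Qed.

Lemma tsum_sum (U : lmodType k) (b : V -> W -> U) I (r : seq I) P F :
  is_bilinear b ->
  tsum (\sum_(i <- r | P i) F i) b = \sum_(i <- r | P i) tsum (F i) b.
Proof.
move=> hb; elim/big_rec2: _ => [|i u z _ <-]; first exact: tsum0.
exact: tsumD.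
Qed.

Lemma eq_tsum (U : lmodType k) (b b' : V -> W -> U) z :
  (forall v w, b v w = b' v w) -> tsum z b = tsum z b'.
Proof. by move=> e; apply: eq_bigr => p _. Qed.

End Two.

Lemma tsum_exchange (V W V' W' U : lmodType k) (z : tens V W) (z' : tens V' W')
    (b : V -> W -> V' -> W' -> U) :
  \tsum_(v, w <- z) \tsum_(v', w' <- z') b v w v' w' =
  \tsum_(v', w' <- z') \tsum_(v, w <- z) b v w v' w'.
Proof. exact: exchange_big. Qed.

Lemma tsum_mul (A B : algType k) (U : lmodType k) (z z' : tens A B)
    (b : A -> B -> U) :
  is_bilinear b ->
  tsum (tens_mul z z') b =
  \tsum_(a1, a2 <- z) \tsum_(b1, b2 <- z') b (a1 * b1) (a2 * b2).
Proof.
move=> hb; rewrite /tens_mul [in LHS]/tsum.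
rewrite [X in fsum _ (tens_repr X)]/fsum.
(* Shows the outer sum as an ordinary big sum in the space of tensors, over which the map induced by
   [b] distributes. *)
change (tsum (\sum_(p <- tens_repr z) \tsum_(c, d <- z')
    ((p.1 * c) \ot (p.2 * d))) b =
  \tsum_(a1, a2 <- z) \tsum_(b1, b2 <- z') b (a1 * b1) (a2 * b2)).
rewrite tsum_sum //; apply: eq_bigr => p _.
by rewrite tsum_sum //; apply: eq_bigr => p' _; rewrite tsum_pure.
Qed.

Lemma tens_mul_pure (A B : algType k) (a a' : A) (b b' : B) :
  tens_mul (a \ot b) (a' \ot b') = (a * a') \ot (b * b').
Proof.
apply: tens_eqP => U f hf; rewrite tsum_mul // tsum_pure.
  by rewrite !tsum_pure //; split=> [w c v v'|v c w w'];
    rewrite mulrDr -scalerAr ?(hf.1 _ _ _ _) ?(hf.2 _ _ _ _).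
split=> [w c v v'|v c w w'].
  rewrite /tsum /fsum /= scaler_sumr -big_split /=; apply: eq_bigr => p _ /=.
  by rewrite mulrDl -scalerAl (hf.1 _ _ _ _).
rewrite /tsum /fsum /= scaler_sumr -big_split /=; apply: eq_bigr => p _ /=.
by rewrite mulrDl -scalerAl (hf.2 _ _ _ _).
Qed.
End Tsum.

(** * The operators [h |-> sum phi(h_1) h_2] *)

Section Hit.
Variables (k : fieldType) (H : hopfAlgebra k).
Implicit Types (phi : H -> k) (g h w x y : H).

Definition hit phi h : H := \tsum_(h1, h2 <- comul h) (phi h1 *: h2).

Lemma hit_bilinear phi :
  scalar phi -> is_bilinear (fun h1 h2 : H => phi h1 *: h2).
Proof.
move=> hp; split=> [w a v v'|v a w w'] /=.
  by rewrite hp scalerDl scalerA.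
by rewrite scalerDr !scalerA mulrC.
Qed.

Lemma hit_linear phi : scalar phi -> linear (hit phi).
Proof.
by move=> hp a g h; rewrite /hit linearP (tsum_linear (hit_bilinear hp)).
Qed.

Lemma hit_sum phi I (r : seq I) P (F : I -> H) : scalar phi ->
  hit phi (\sum_(i <- r | P i) F i) = \sum_(i <- r | P i) hit phi (F i).
Proof.
move=> hp; rewrite /hit raddf_sum; exact: tsum_sum (hit_bilinear hp).
Qed.

Lemma hit1 phi : scalar phi -> hit phi 1 = phi 1 *: 1.
Proof. by move=> hp; rewrite /hit comul1 tsum_pure //; apply: hit_bilinear. Qed.

Lemma eq_hit phi psi h : phi =1 psi -> hit phi h = hit psi h.
Proof. by move=> e; apply: eq_tsum => a b; rewrite e. Qed.

Lemma hit_grouplike phi g : scalar phi -> grouplike g -> hit phi g = phi g *: g.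
Proof.
by move=> hp [_ dg]; rewrite /hit dg tsum_pure //; apply: hit_bilinear.
Qed.

Lemma hitZ c phi h : hit (fun g => c * phi g) h = c *: hit phi h.
Proof.
by rewrite /hit /tsum /fsum scaler_sumr; apply: eq_bigr => p _; rewrite scalerA.
Qed.

Lemma hitM phi g h : scalar phi ->
  hit phi (g * h) =
  \tsum_(g1, g2 <- comul g) \tsum_(h1, h2 <- comul h) (phi (g1 * h1) *: (g2 * h2)).
Proof. by move=> hp; rewrite /hit comulM tsum_mul //; apply: hit_bilinear. Qed.

Lemma hitM_bilinear phi g1 g2 : scalar phi ->
  is_bilinear (fun h1 h2 : H => phi (g1 * h1) *: (g2 * h2)).
Proof.
move=> hp; split=> [w a v v'|v a w w'] /=.
  by rewrite mulrDr -scalerAr hp scalerDl scalerA.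
by rewrite mulrDr -scalerAr scalerDr !scalerA mulrC.
Qed.

Lemma tsum_scaleMr phi g z :
  \tsum_(h1, h2 <- z) (phi h1 *: (h2 * g)) =
  (\tsum_(h1, h2 <- z) (phi h1 *: h2)) * g :> H.
Proof.
by rewrite /tsum /fsum mulr_suml; apply: eq_bigr => p _; rewrite scalerAl.
Qed.

Lemma hitM_grouplike phi h g : scalar phi -> grouplike g ->
  hit phi (h * g) = hit (fun h => phi (h * g)) h * g.
Proof.
move=> hp [_ dg]; rewrite hitM // dg -tsum_scaleMr; apply: eq_tsum => a b.
by rewrite tsum_pure //; apply: hitM_bilinear.
Qed.

(** The coproduct of [h * x] is the sum of the terms [(h1 * w) \ot (h2 * x)] and [(h1 * x) \ot h2].
    In the second kind the factor [x] has passed into the functional, which is how the degree in [x]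
    drops. *)
Lemma hitM_skew phi h w x : scalar phi -> skew_primitive w 1 x ->
  hit phi (h * x) =
  hit (fun h => phi (h * w)) h * x + hit (fun h => phi (h * x)) h.
Proof.
move=> hp dx; rewrite hitM // -tsum_scaleMr /hit /tsum /fsum -big_split.
apply: eq_bigr => p _; rewrite -/(tsum _ _) /= dx.
have hb := hitM_bilinear p.1 p.2 hp.
by rewrite [LHS](tsumD _ _ hb) !tsum_pure // mulr1.
Qed.

End Hit.

(** * Counits of grouplike and skew primitive elements *)

Lemma grouplike_counit (k : fieldType) (H : hopfAlgebra k) (g : H) :
  grouplike g -> counit g = 1.
Proof.
move=> [g0 dg]; have := counitl g; rewrite dg tsum_pure.
  move/eqP; rewrite -subr_eq0 -[X in _ - X]scale1r -scalerBl scaler_eq0.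
  by rewrite (negPf g0) orbF subr_eq0 => /eqP.
by apply: hit_bilinear => a u v; apply: linearP.
Qed.

(** The counit axiom reads [counit g *: x + counit x *: 1 = x] with [counit g = 1]; and [1] is
    nonzero because [g] is. *)
Lemma skew_primitive_counit (k : fieldType) (H : hopfAlgebra k) (g x : H) :
  grouplike g -> skew_primitive g 1 x -> counit x = 0.
Proof.
move=> g_gl dx; have hb : is_bilinear (fun a b : H => counit a *: b).
  by apply: hit_bilinear => a u v; apply: linearP.
have := counitl x; rewrite dx [LHS](tsumD _ _ hb) !tsum_pure //.
rewrite (grouplike_counit g_gl) scale1r => /(canRL (addKr _)); rewrite addNr.
case: g_gl => g0 _ /eqP; rewrite scaler_eq0 => /orP[/eqP //|/eqP one0].
by rewrite -[g]mulr1 one0 mulr0 eqxx in g0.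
Qed.

Lemma horner_alg_scale (F : fieldType) (A : algType F) c (a : A) p :
  horner_alg (c *: a) p = horner_alg a (p \Po (c *: 'X)).
Proof.
elim/poly_ind: p => [|p d IHp]; first by rewrite comp_poly0 !rmorph0.
rewrite comp_poly_MXaddC !rmorphD !rmorphM /= !horner_algX !horner_algC IHp.
by rewrite linearZ /= horner_algX mulr_algl.
Qed.

(** * Lowering the degree in [x] along a chain of functionals *)

Section HitMonomial.
Variables (k : fieldType) (H : hopfAlgebra k) (x y : H) (m : nat).
Hypotheses (y_gl : grouplike y) (x_skew : skew_primitive (y ^+ m) 1 x).
Variables (phi : nat -> H -> k) (a b : nat -> k).
Hypotheses (phi_lin : forall l, scalar (phi l))
  (phi_y : forall l h, phi l (h * y) = a l * phi l h)
  (phi_x : forall l h, phi l (h * x) = b l * phi l.+1 h).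

Let phi_yX l h j : phi l (h * y ^+ j) = a l ^+ j * phi l h.
Proof.
elim: j h => [|j IHj] h; first by rewrite !expr0 mulr1 mul1r.
by rewrite exprSr mulrA phi_y IHj mulrA exprS.
Qed.

Lemma hit_poly l p :
  hit (phi l) (horner_alg y p) = phi l 1 *: horner_alg (a l *: y) p.
Proof.
elim/poly_ind: p => [|p c IHp].
  rewrite !rmorph0 scaler0; have := hit_linear (phi_lin l) (-1) 0 0.
  by rewrite scaler0 addr0 scaleN1r addNr.
rewrite !rmorphD !rmorphM /= !horner_algX !horner_algC addrC hit_linear //.
rewrite hit1 // hitM_grouplike // (eq_hit _ (phi_y l)) hitZ IHp addrC scalerDr.
by rewrite -scalerAr -!scalerAl !scalerA [c * _]mulrC [a l * _]mulrC.
Qed.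

(** Each factor [x] is either left outside with [phi l] kept, or absorbed with [phi l] replaced by
    [phi l.+1]. Every resulting term thus carries some [phi (l + i) 1] with [i <= s]. *)
Lemma hit_monomial_eq0 l p s : (forall i, (i <= s)%N -> phi (l + i) 1 = 0) ->
  hit (phi l) (horner_alg y p * x ^+ s) = 0.
Proof.
elim: s l => [|s IHs] l h0.
  by rewrite mulr1 hit_poly -[l]addn0 h0 // scale0r.
rewrite exprSr mulrA (hitM_skew _ _ x_skew) // (eq_hit _ (phi_x l)) hitZ.
rewrite (eq_hit _ (fun h => phi_yX l h m)) hitZ !IHs ?scaler0 ?mul0r ?addr0 //.
  by move=> i lti; rewrite addSnnS h0.
by move=> i lti; rewrite h0 // leqW.
Qed.

(** Only the term in which all [s] factors [x] are absorbed survives. It has degree [0] in [x], and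
    its coefficient collects the constants [b] met along the chain. *)
Lemma hit_monomial l p s : (forall i, (i < s)%N -> phi (l + i) 1 = 0) ->
  hit (phi l) (horner_alg y p * x ^+ s) =
  (\prod_(i < s) b (l + i) * phi (l + s) 1) *: horner_alg (a (l + s) *: y) p.
Proof.
elim: s l => [|s IHs] l h0.
  by rewrite mulr1 hit_poly addn0 big_ord0 mul1r.
rewrite exprSr mulrA (hitM_skew _ _ x_skew) // (eq_hit _ (phi_x l)) hitZ.
rewrite (eq_hit _ (fun h => phi_yX l h m)) hitZ.
rewrite hit_monomial_eq0 // scaler0 mul0r add0r IHs; last first.
  by move=> i lti; rewrite addSnnS h0.
rewrite scalerA mulrA big_ord_recl addn0 addSnnS.
by congr ((_ * _ * _) *: _); apply: eq_bigr => i _; rewrite addSnnS.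
Qed.

End HitMonomial.

(** * Roots of unity and evaluation of polynomials *)

Lemma prim_root_neq0 (F : fieldType) n (z : F) : n.-primitive_root z -> z != 0.
Proof.
move=> zP; apply/eqP => z0; have := prim_expr_order zP.
rewrite z0 expr0n gtn_eqF ?(prim_order_gt0 zP) // => /esym/eqP.
by rewrite oner_eq0.
Qed.

Lemma dvdp_Xn_sub_1 (F : fieldType) n (z : F) (p : {poly F}) :
  n.-primitive_root z -> (forall i, root p (z ^+ i)) -> ('X^n - 1) %| p.
Proof.
move=> zP h; rewrite -(factor_Xn_sub_1 zP) -(big_map _ xpredT (fun a => 'X - a%:P)).
apply: uniq_roots_dvdp; first by apply/allP => _ /mapP[i _ ->].
rewrite uniq_rootsE map_inj_in_uniq ?iota_uniq // => i j.
rewrite !mem_index_iota /= => lt_in lt_jn /eqP.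
by rewrite (eq_prim_root_expr zP) !modn_small // => /eqP.
Qed.

Lemma lrmorph_horner (F : fieldType) (A : algType F) (f : {lrmorphism A -> F^o})
    (a : A) p : f (horner_alg a p) = p.[f a].
Proof.
elim/poly_ind: p => [|p c IHp]; first by rewrite !rmorph0 horner0.
rewrite rmorphD rmorphM /= horner_algX horner_algC hornerMXaddC.
by rewrite rmorphD rmorphM /= IHp linearZ /= rmorph1 [_ *: _]mulr1.
Qed.

(** * Normal forms, grouplikes and the ideal [H x] *)

Section HnTheory.
Variables (k : fieldType) (n m t N : nat) (zeta : k).
Hypotheses (zeta_prim : n.-primitive_root zeta)
  (N_ord : N.-primitive_root (zeta ^+ (m * t))).
Variables (H : hopfAlgebra k) (y x : H).
Hypothesis (H_is_Hn : is_Hn n m t N zeta y x).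

Let n_gt0 := prim_order_gt0 zeta_prim.
Let N_gt0 := prim_order_gt0 N_ord.

Lemma Hn_yn : y ^+ n = 1. Proof. by case: (Hn_relP H_is_Hn). Qed.
Lemma Hn_xN : x ^+ N = 0. Proof. by case: (Hn_relP H_is_Hn). Qed.
Lemma Hn_yx : y * x = zeta ^+ t *: (x * y).
Proof. by case: (Hn_relP H_is_Hn). Qed.

Lemma Hn_xy : x * y = zeta ^- t *: (y * x).
Proof.
rewrite Hn_yx scalerA mulVf ?scale1r // expf_neq0 //.
exact: prim_root_neq0 zeta_prim.
Qed.

Lemma Hn_xXy j : x ^+ j * y = zeta ^- (t * j) *: (y * x ^+ j).
Proof.
elim: j => [|j IHj]; first by rewrite muln0 invr1 scale1r mul1r mulr1.
rewrite exprSr -mulrA Hn_xy -scalerAr [x ^+ j * (y * x)]mulrA.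
rewrite IHj -scalerAl scalerA -mulrA.
by rewrite -invfM -exprD mulnS.
Qed.

(** The elements of this form contain [1], make up a subspace, and are stable under right
    multiplication by [y] and by [x], hence by all of [H]. *)
Lemma Hn_expand h :
  exists p : nat -> {poly k}, h = \sum_(j < N) horner_alg y (p j) * x ^+ j.
Proof.
pose P h := exists p : nat -> {poly k},
  h = \sum_(j < N) horner_alg y (p j) * x ^+ j.
have P1 : P 1.
  exists (fun j => (j == 0)%N%:R); rewrite -(prednK N_gt0) big_ord_recl.
  by rewrite rmorph1 mulr1 big1 ?addr0 // => i _; rewrite rmorph0 mul0r.
have PD a b : P a -> P b -> P (a + b).
  move=> [p ->] [q ->]; exists (fun j => p j + q j); rewrite -big_split.
  by apply: eq_bigr => j _; rewrite rmorphD mulrDl.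
have PZ (c : k) a : P a -> P (c *: a).
  move=> [p ->]; exists (fun j => c%:P * p j); rewrite scaler_sumr.
  by apply: eq_bigr => j _; rewrite rmorphM /= horner_algC -!scalerAl mul1r.
suff PM b : forall a, P a -> P (a * b) by rewrite -[h]mul1r; apply: PM.
apply: (Hn_gen H_is_Hn (S := fun b => forall a, P a -> P (a * b))).
- by move=> a; rewrite mulr1.
- by move=> b1 b2 h1 h2 a Pa; rewrite mulrDr; apply: PD; [apply: h1|apply: h2].
- by move=> c b' h' a Pa; rewrite -scalerAr; apply/PZ/h'.
- by move=> b1 b2 h1 h2 a Pa; rewrite mulrA; apply/h2/h1.
- move=> _ [p ->]; exists (fun j => (zeta ^- (t * j))%:P * (p j * 'X)).
  rewrite mulr_suml; apply: eq_bigr => j _.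
  rewrite -mulrA Hn_xXy !rmorphM /= horner_algC horner_algX -scalerAr -!scalerAl.
  by rewrite mul1r mulrA.
(* Multiplying by [x] shifts the coefficients by one; the top one disappears because
   [x ^+ N = 0]. *)
- move=> _ [p ->]; exists (fun j => if j is j'.+1 then p j' else 0).
  rewrite -(prednK N_gt0) [RHS]big_ord_recl big_ord_recr /= rmorph0 mul0r add0r.
  rewrite mulrDl -(mulrA (horner_alg y _)) -exprSr (prednK N_gt0) Hn_xN mulr0 addr0.
  by rewrite mulr_suml; apply: eq_bigr => j _; rewrite -mulrA -exprSr.
Qed.

(** The scalars [zeta ^+ c] and [0] satisfy the defining relations. These characters evaluate a
    polynomial in [y] at every [n]-th root of unity. *)
Lemma Hn_char c : exists f : {lrmorphism H -> k^o}, f y = zeta ^+ c /\ f x = 0.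
Proof.
apply: (Hn_univ H_is_Hn); split.
- by rewrite exprAC (prim_expr_order zeta_prim) expr1n.
- by rewrite expr0n; case: N N_gt0.
- by rewrite mulr0 mul0r scaler0.
Qed.

Lemma Hn_horner_eq0 p :
  (forall i, root p (zeta ^+ i)) -> horner_alg y p = 0.
Proof.
move=> /(dvdp_Xn_sub_1 zeta_prim) /dvdpP[q ->].
by rewrite rmorphM rmorphB rmorph1 rmorphXn /= horner_algX Hn_yn subrr mulr0.
Qed.

(* Matrix coefficients, in row [j], of the module with basis
   [w_0, ..., w_(N-1)], where [x w_l = w_(l+1)] and
   [y w_l = zeta ^+ (c + t * l) w_l]. *)
Lemma Hn_coef c j : (j < N)%N -> exists phi : nat -> H -> k,
  [/\ forall l, scalar (phi l),
      forall l h, phi l (h * y) = zeta ^+ (c + t * l) * phi l h,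
      forall l h, phi l (h * x) = 1 * phi l.+1 h
    & forall l, phi l 1 = (l == j)%:R].
Proof.
case EN: N => [//|N'] lt_jN.
pose Y : 'M[k]_N'.+1 := diag_mx (\row_l zeta ^+ (c + t * l)).
pose X : 'M[k]_N'.+1 := \matrix_(i, l) (i == l.+1 :> nat)%:R.
have [] := Hn_univ H_is_Hn (B := 'M[k]_N'.+1) (y' := Y) (x' := X).
  split.
  - suff YX i : Y ^+ i = diag_mx (\row_l (zeta ^+ (c + t * l)) ^+ i).
      rewrite YX; apply/matrixP => r s; rewrite !mxE exprAC.
      by rewrite (prim_expr_order zeta_prim) expr1n.
    elim: i => [|i IHi].
      by apply/matrixP => r s; rewrite expr0 !mxE.
    rewrite exprS IHi [LHS]mulmx_diag; congr diag_mx; apply/rowP => r.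
    by rewrite !mxE exprS.
  - suff XX i : X ^+ i = \matrix_(r, l) (r == l + i :> nat)%N%:R.
      rewrite XX EN; apply/matrixP => r s; rewrite !mxE.
      by case: eqP => // e; have := ltn_ord r; rewrite e ltnNge leq_addl.
    elim: i => [|i IHi].
      by apply/matrixP => r s; rewrite expr0 !mxE addn0.
    apply/matrixP => r s; rewrite exprSr IHi mxE.
    have [lt_sN|le_Ns] := ltnP s.+1 N'.+1.
      rewrite (bigD1 (Ordinal lt_sN)) //= !mxE eqxx mulr1 addSnnS.
      rewrite big1 ?addr0 // => l /eqP ne_l; rewrite !mxE.
      case: (nat_of_ord l =P s.+1) => [e|]; rewrite ?mulr0 //.
      by case: ne_l; apply: val_inj.
    rewrite big1 => [|l _]; rewrite !mxE.
      case: eqP => // e; have := ltn_ord r.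
      by rewrite e addnS ltnS leqNgt (leq_trans le_Ns) // ltnS leq_addr.
    case: (nat_of_ord l =P s.+1) => [e|]; rewrite ?mulr0 //.
    by have := ltn_ord l; rewrite e ltnNge le_Ns.
  - rewrite [Y * X]mul_diag_mx [X * Y]mul_mx_diag.
    apply/matrixP => r s; rewrite !mxE.
    case: eqP => [->|]; rewrite ?mul0r ?mulr0 // mul1r mulr1 -exprD mulnS.
    by rewrite addnCA.
move=> M [My Mx].
(* The default [0] beyond the basis agrees with [x w_(N-1) = 0], so the rule for [h * x] also holds
   at the last index. *)
pose phi l h := if (l < N'.+1)%N then M h (Ordinal lt_jN) (inord l) else 0.
exists phi; split=> [l a g h|l h|l h|l]; rewrite /phi; case: ifP => lt_l.
- by rewrite linearP !mxE.
- by rewrite mulr0 addr0.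
- rewrite rmorphM /= My [LHS](congr1 (fun A : 'M_ _ => A _ _)(mul_mx_diag _ _)).
  by rewrite !mxE inordK // mulrC.
- by rewrite mulr0.
- rewrite rmorphM /= Mx mul1r mxE; case: ifP => [lt_lN|ge_lN].
    rewrite (bigD1 (inord l.+1)) //= !mxE !inordK // eqxx mulr1.
    rewrite big1 ?addr0 // => i /eqP ne_l; rewrite !mxE inordK //.
    case: eqP => [e|]; rewrite ?mulr0 //; case: ne_l.
    by apply: val_inj; rewrite /= inordK.
  apply: big1 => i _; rewrite !mxE inordK //; case: eqP => [e|]; rewrite ?mulr0 //.
  by have := ltn_ord i; rewrite e ge_lN.
- by case: ifP => [/ltnW|]; rewrite ?lt_l // mulr0.
- by rewrite rmorph1 mxE -val_eqE /= inordK // eq_sym.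
- by case: eqP => // e; have := lt_jN; rewrite -e lt_l.
Qed.

Lemma Hn_one_neq0 : 1 != 0 :> H.
Proof.
case: (Hn_grouplike H_is_Hn) => y0 _; apply: contraNneq y0 => one0.
by rewrite -[y]mulr1 one0 mulr0.
Qed.

Lemma Hn_grouplikeX i : grouplike (y ^+ i).
Proof.
split.
  apply: contra_neq Hn_one_neq0 => yi0.
  rewrite -(expr1n _ i) -Hn_yn -exprM mulnC exprM.
  by rewrite -(prednK n_gt0) exprS yi0 mul0r.
elim: i => [|i IHi]; first exact: comul1.
rewrite exprS comulM IHi; case: (Hn_grouplike H_is_Hn) => _ ->.
by rewrite tens_mul_pure.
Qed.

Lemma Hn_grouplike_poly d (p : nat -> {poly k}) g : (d < N)%N -> grouplike g ->
  g = \sum_(j < d.+1) horner_alg y (p j) * x ^+ j ->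
  exists r, g = horner_alg y r.
Proof.
move=> + g_gl; elim: d => [_ -> | d IHd lt_dN gE].
  by exists (p 0); rewrite big_ord1 mulr1.
have [h|/existsNP[i /negP p_i]] := pselect (forall i, root (p d.+1) (zeta ^+ i)).
  apply: IHd; first exact: ltnW.
  by rewrite gE big_ord_recr /= Hn_horner_eq0 // mul0r addr0.
(* With this offset, [y] acts on the basis vector of index [d.+1] by exactly [zeta ^+ i], since
   [n.-1] is [-1] modulo [n]. *)
have [phi [phi_lin phi_y phi_x phi1]] := Hn_coef (i + n.-1 * (t * d.+1)) lt_dN.
have gl_hit := hit_grouplike (phi_lin 0) g_gl.
move: gl_hit; rewrite {1}gE hit_sum // big_ord_recr /= big1 ?add0r => [|j _];
  last first.
  rewrite (hit_monomial_eq0 (Hn_grouplike H_is_Hn) (Hn_skew H_is_Hn)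
    phi_lin phi_y phi_x) //.
  by move=> l le_lj; rewrite phi1 ltn_eqF // (leq_ltn_trans le_lj).
rewrite (hit_monomial (Hn_grouplike H_is_Hn) (Hn_skew H_is_Hn)
  phi_lin phi_y phi_x);
  last by move=> l lt_ld; rewrite phi1 ltn_eqF.
rewrite big1 // phi1 eqxx mul1r scale1r add0n -addnA -[X in (_ + X)%N]mulSnr prednK //.
rewrite exprD exprM (prim_expr_order zeta_prim) expr1n mulr1 horner_alg_scale.
set q := _ \Po _ => qE.
have [phi0|phi_neq0] := eqVneq (phi 0 g) 0.
  (* The character with [y] sent to [1] evaluates [q] at [1], that is, the leading coefficient at
     [zeta ^+ i], where it is nonzero. *)
  have [f [fy _]] := Hn_char 0.
  have := congr1 f qE; rewrite phi0 scale0r rmorph0 lrmorph_horner fy.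
  rewrite horner_comp hornerZ hornerX mulr1 => /eqP q0.
  by case/negP: p_i; rewrite /root q0.
exists ((phi 0 g)^-1 *: q); rewrite linearZ /= qE mulr_algl scalerA mulVf //.
by rewrite scale1r.
Qed.

(** Write [g] as [r] evaluated at [y]. Applying [hit] with the characters shows that [r] is
    multiplicative on the powers of [zeta], so [r.[zeta]] is some [zeta ^+ i], and [r] agrees with
    ['X^i] at every [n]-th root of unity. *)
Lemma Hn_grouplikeP g : grouplike g -> exists i : 'I_n, g = y ^+ i.
Proof.
move=> g_gl; have [p gE] := Hn_expand g.
have [||r {p}gE] := @Hn_grouplike_poly N.-1 p g _ g_gl.
- by rewrite prednK.
- by rewrite (prednK N_gt0).
have hitr c : horner_alg (zeta ^+ c *: y) r = r.[zeta ^+ c] *: g.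
  have [f [fy fx]] := Hn_char c.
  have f_lin : scalar (fun h => f h : k) by move=> a u v; apply: linearP.
  have f_y : forall (l : nat) h, f (h * y) = zeta ^+ c * f h :> k.
    by move=> _ h; rewrite rmorphM /= fy [LHS]mulrC.
  have f_x : forall (l : nat) h, f (h * x) = 0 * f h :> k.
    by move=> _ h; rewrite rmorphM /= fx mul0r [LHS]mulr0.
  have := hit_poly (Hn_grouplike H_is_Hn) (fun=> f_lin) f_y 0 r.
  by rewrite -gE hit_grouplike // rmorph1 scale1r {1}gE lrmorph_horner fy.
have r_mul c i : r.[zeta ^+ (c + i)] = r.[zeta ^+ c] * r.[zeta ^+ i].
  have [f [fy _]] := Hn_char i.
  have := congr1 f (hitr c); rewrite linearZ /= gE !lrmorph_horner linearZ /= fy.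
  by rewrite [_ *: _](esym (exprD _ _ _)).
have r1 : r.[1] = 1.
  have := hitr 0; rewrite expr0 scale1r -gE => /eqP.
  rewrite -subr_eq0 -[X in X - _]scale1r -scalerBl scaler_eq0 subr_eq0.
  by case: g_gl => /negPf -> _; rewrite orbF => /eqP <-.
have rX i : r.[zeta ^+ i] = r.[zeta] ^+ i.
  elim: i => [|i IHi]; first by rewrite r1.
  by rewrite [RHS]exprSr -IHi -[in LHS]addn1 r_mul.
have [i ri] : {i : 'I_n | r.[zeta] = zeta ^+ i}.
  by apply: (prim_rootP zeta_prim); rewrite -rX (prim_expr_order zeta_prim) r1.
exists i; apply/eqP; rewrite gE -subr_eq0.
rewrite -[y in y ^+ i]horner_algX -rmorphXn -rmorphB; apply/eqP.
apply: Hn_horner_eq0 => j.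
by rewrite /root hornerD hornerN hornerXn rX ri exprAC subrr.
Qed.

(** * The Hopf ideal [H x] *)

Definition xideal : H -> Prop := fun h => exists a, h = a * x.

Lemma xideal0 : xideal 0. Proof. by exists 0; rewrite mul0r. Qed.

Lemma xidealD a b : xideal a -> xideal b -> xideal (a + b).
Proof. by move=> [a' ->] [b' ->]; exists (a' + b'); rewrite mulrDl. Qed.

Lemma xidealMl a b : xideal b -> xideal (a * b).
Proof. by move=> [b' ->]; exists (a * b'); rewrite mulrA. Qed.

Lemma xidealZ (c : k) a : xideal a -> xideal (c *: a).
Proof. by move=> [a' ->]; exists (c *: a'); rewrite scalerAl. Qed.

(** It is enough that [x * b] stays in [H x], a condition stable under sums and products; for
    [b = y] it holds because [x * y] is a multiple of [y * x]. *)
Lemma xidealMr a b : xideal a -> xideal (a * b).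
Proof.
move=> [{}a ->]; rewrite -mulrA; apply: xidealMl.
apply: (Hn_gen H_is_Hn (S := fun b => xideal (x * b))).
- by exists 1; rewrite mulr1 mul1r.
- by move=> b1 b2 h1 h2; rewrite mulrDr; apply: xidealD.
- by move=> c b'; rewrite -scalerAr; apply: xidealZ.
- move=> b1 b2 [b1' e] h2; rewrite mulrA e -mulrA; exact: xidealMl.
- by rewrite Hn_xy; apply/xidealZ; exists y.
- by exists x.
Qed.

(* Modulo [H x], [antipode_conv c (h * x)] equals [antipode_conv (x * c) h].
   Going from [antipode_conv 1 (y ^ i * x ^ j.+1)], which is a counit, to
   [antipode_conv (x ^ j.+1) (y ^ i)] puts
   [antipode (y ^ i * x ^ j.+1) * y ^ i] in [H x]. *)
Let antipode_conv c h : H := \tsum_(h1, h2 <- comul h) (antipode (h1 * c) * h2).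

Let antipode_conv_bilinear c g h :
  is_bilinear (fun h1 h2 : H => antipode (g * h1 * c) * (h * h2)).
Proof.
split=> [w a v v'|v a w w'] /=.
  by rewrite mulrDr mulrDl -scalerAr -scalerAl linearP mulrDl -scalerAl.
by rewrite mulrDr -scalerAr mulrDr -scalerAr.
Qed.

Let antipode_conv_bilinear1 c :
  is_bilinear (fun h1 h2 : H => antipode (h1 * c) * h2).
Proof.
split=> [w a v v'|v a w w'] /=.
  by rewrite mulrDl -scalerAl linearP mulrDl -scalerAl.
by rewrite mulrDr -scalerAr.
Qed.

Let antipode_convM c h : exists2 r, xideal r &
  antipode_conv c (h * x) = r + antipode_conv (x * c) h.
Proof.
exists ((\tsum_(h1, h2 <- comul h) (antipode (h1 * y ^+ m * c) * h2)) * x).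
  by eexists.
rewrite /antipode_conv comulM tsum_mul // /tsum /fsum mulr_suml -big_split.
apply: eq_bigr => p _ /=; rewrite -/(tsum _ _) (Hn_skew H_is_Hn).
have hb := antipode_conv_bilinear c p.1 p.2.
by rewrite [LHS](tsumD _ _ hb) !tsum_pure // mulr1 !mulrA.
Qed.

Lemma antipode_xideal h : xideal h -> xideal (antipode h).
Proof.
move=> [a ->]; have [p ->] := Hn_expand a.
rewrite mulr_suml linear_sum; apply: big_ind => [||j _];
  [exact: xideal0|exact: xidealD|].
rewrite -mulrA -exprSr -[p j]coefK poly_def linear_sum mulr_suml linear_sum.
apply: big_ind => [||i _]; [exact: xideal0|exact: xidealD|].
rewrite linearZ /= mulr_algl -scalerAl linearZ; apply: xidealZ.
rewrite rmorphXn /= horner_algX.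
move: (nat_of_ord i) => {}i; move: (nat_of_ord j) => {}j.
(* The [j.+1] factors [x] are moved one at a time from the second argument to the first; [l] counts
   those already there. *)
suff conv l z : xideal (antipode_conv (x ^+ l) (z * x ^+ j.+1) -
    antipode_conv (x ^+ (l + j.+1)) z).
  have := conv 0 (y ^+ i); rewrite /antipode_conv.
  rewrite (eq_tsum _ (b' := fun h1 h2 : H => antipode h1 * h2)) => [|v w];
    last by rewrite mulr1.
  rewrite antipodel; case: (Hn_grouplikeX i) => _ ->; rewrite tsum_pure //.
  have yX_m := Hn_grouplikeX m; have yX_i := Hn_grouplikeX i.
  rewrite exprSr mulrA rmorphM /= (skew_primitive_counit yX_m (Hn_skew H_is_Hn)).
  rewrite mulr0 scale0r sub0r -scaleN1r => /(xidealZ (-1)).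
  (* The factor [y ^+ i] is cancelled by its inverse [y ^+ (n.-1 * i)]. *)
  rewrite scalerA mulrN1 opprK scale1r => /(xidealMr (y ^+ (n.-1 * i))).
  by rewrite -mulrA -exprD -mulSn prednK // exprM Hn_yn expr1n mulr1.
elim: j l z => [|j IHj] l z.
  have [r rI ->] := antipode_convM (x ^+ l) z.
  by rewrite -exprS addn1 addrK.
rewrite exprSr mulrA; have [r rI ->] := antipode_convM (x ^+ l) (z * x ^+ j.+1).
by rewrite -exprS -addSnnS -addrA; apply/xidealD/IHj.
Qed.

(** The coproduct of [a * x] splits into the terms [(a1 * x) \ot a2] and
    [(a1 * y ^+ m) \ot (a2 * x)], each with one factor in [H x]. *)
Lemma hopf_ideal_xideal : hopf_ideal xideal.
Proof.
split; [exact: xideal0|exact: xidealD|exact: xidealMl|exact: xidealMr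
  | | |exact: antipode_xideal].
- move=> _ [a ->].
  exists (\tsum_(a1, a2 <- comul a) ((a1 * x) \ot a2)).
  exists (\tsum_(a1, a2 <- comul a) ((a1 * y ^+ m) \ot (a2 * x))).
  split.
  + exists [seq (p.1 * x, p.2) | p <- tens_repr (comul a)].
    rewrite big_map; split=> // q /mapP[p _ ->]; split=> //.
    by exists p.1.
  + exists [seq (p.1 * y ^+ m, p.2 * x) | p <- tens_repr (comul a)].
    rewrite big_map; split=> // q /mapP[p _ ->]; split=> //.
    by exists p.2.
  + rewrite comulM /tens_mul /tsum /fsum -big_split; apply: eq_bigr => p _ /=.
    rewrite -/(tsum _ _) (Hn_skew H_is_Hn).
    have hb : is_bilinear (fun c d : H => (p.1 * c) \ot (p.2 * d)).
      split=> [w c v v'|v c w w'] /=; rewrite mulrDr -scalerAr.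
        exact: (tpure_bilinear H H).1.
      exact: (tpure_bilinear H H).2.
    by rewrite [LHS](tsumD _ _ hb) !tsum_pure // mulr1 addrC.
- move=> _ [a ->]; rewrite rmorphM /=.
  by rewrite (skew_primitive_counit (Hn_grouplikeX m) (Hn_skew H_is_Hn)) mulr0.
Qed.

(** When [N > 1] the matrix of [x] sends [w_0] to [w_1], so the coefficient of [x] in row [1] and
    column [0] is [1]. *)
Lemma Hn_x_neq0 : (1 < N)%N -> x != 0.
Proof.
move=> N_gt1; have [phi [phi_lin _ phi_x phi1]] := Hn_coef 0 N_gt1.
apply/eqP => x0; have := phi_x 0 1; rewrite phi1 mul1r mul1r x0.
have := phi_lin 0 (-1) 0 0; rewrite scaler0 addr0 mulN1r addNr => -> /eqP.
by rewrite eq_sym oner_eq0.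
Qed.

End HnTheory.

(** * Constraints on [A(H)] *)

Section CyclicGenerator.
Variables (k : fieldType) (n : nat) (A : algType k) (u : A).
Hypotheses (n_gt0 : (0 < n)%N) (u_gen : cyclic_generator n u).

Lemma cyclic_generator_expn : u ^+ n = 1.
Proof.
apply/eqP; rewrite -subr_eq0; have /= := (u_gen.2 ('X^n - 1)).2 (dvdpp _).
by rewrite rmorphB rmorph1 rmorphXn /= horner_algX => ->.
Qed.

Lemma cyclic_generator_one_neq0 : 1 != 0 :> A.
Proof.
apply/eqP => one0; have := (u_gen.2 1).1; rewrite rmorph1 => /(_ one0).
by rewrite dvdp1 size_XnsubC // eqSS gtn_eqF.
Qed.

Lemma cyclic_generator_exp_neq0 i : u ^+ i != 0.
Proof.
apply: contra_neq cyclic_generator_one_neq0 => ui0.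
rewrite -(expr1n _ i) -cyclic_generator_expn -exprM mulnC exprM.
by rewrite -(prednK n_gt0) exprS ui0 mul0r.
Qed.

Lemma cyclic_generator_span a : exists c : nat -> k, a = \sum_(i < n) c i *: u ^+ i.
Proof.
have [p ->] := u_gen.1 a; pose r := p %% ('X^n - 1).
have size_r : (size r <= n)%N.
  by rewrite -ltnS -(size_XnsubC (1 : k) n_gt0) ltn_modp monic_neq0 // monicXnsubC.
exists (fun i => r`_i); rewrite {1}(divp_eq p ('X^n - 1)) -/r rmorphD rmorphM /=.
rewrite rmorphB rmorph1 rmorphXn /= horner_algX cyclic_generator_expn subrr mulr0.
rewrite add0r -[r in LHS](take_poly_id size_r) /take_poly poly_def linear_sum.
by apply: eq_bigr => i _; rewrite linearZ /= mulr_algl rmorphXn /= horner_algX.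
Qed.

Lemma cyclic_generator_free (c : nat -> k) i :
  \sum_(i < n) c i *: u ^+ i = 0 -> (i < n)%N -> c i = 0.
Proof.
move=> sum0 lt_in; pose p := \poly_(i < n) c i.
have : horner_alg u p = 0.
  rewrite /p poly_def linear_sum -[RHS]sum0.
  by apply: eq_bigr => j _; rewrite linearZ /= mulr_algl rmorphXn /= horner_algX.
move=> /(u_gen.2 p).1 dvdp.
have /eqP p0 : p == 0.
  apply: contraTT isT => p_neq0; have := dvdp_leq p_neq0 dvdp.
  by rewrite size_XnsubC // ltnNge size_poly.
by have := congr1 (fun p : {poly k} => p`_i) p0; rewrite coef_poly lt_in coef0.
Qed.

End CyclicGenerator.

(** Modulo ['X^n - 1] every polynomial has size at most [n], and freeness kills a remainder that
    vanishes at [u]. *)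
Lemma cyclic_generator_of_basis (k : fieldType) n (A : algType k) (u : A) :
  (0 < n)%N -> u ^+ n = 1 ->
  (forall a, exists c : nat -> k, a = \sum_(i < n) c i *: u ^+ i) ->
  (forall c : nat -> k,
    \sum_(i < n) c i *: u ^+ i = 0 -> forall i, (i < n)%N -> c i = 0) ->
  cyclic_generator n u.
Proof.
move=> n_gt0 un span free.
have polyE (c : nat -> k) :
    horner_alg u (\poly_(i < n) c i) = \sum_(i < n) c i *: u ^+ i.
  rewrite poly_def linear_sum; apply: eq_bigr => i _.
  by rewrite linearZ /= mulr_algl rmorphXn /= horner_algX.
split=> [a|p].
  by have [c ->] := span a; exists (\poly_(i < n) c i); rewrite polyE.
have horner_dvd : horner_alg u ('X^n - 1) = 0.
  by rewrite rmorphB rmorph1 rmorphXn /= horner_algX un subrr.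
split=> [|/dvdpP[q ->]]; last by rewrite rmorphM /= horner_dvd mulr0.
pose r := p %% ('X^n - 1); have size_r : (size r <= n)%N.
  by rewrite -ltnS -(size_XnsubC (1 : k) n_gt0) ltn_modp monic_neq0 // monicXnsubC.
rewrite {1}(divp_eq p ('X^n - 1)) -/r rmorphD rmorphM /= horner_dvd mulr0 add0r.
rewrite -[X in horner_alg u X](take_poly_id size_r) polyE => /free r0.
apply/eqP/polyP => i; rewrite coef0; have [/r0//|le_ni] := ltnP i n.
by rewrite nth_default // (leq_trans size_r).
Qed.

(** * The action of [y] and [x] on the powers of [u] *)

Section HnAction.
Variables (k : fieldType) (n m t N : nat) (zeta : k).
Hypotheses (zeta_prim : n.-primitive_root zeta)
  (N_ord : N.-primitive_root (zeta ^+ (m * t))).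
Variables (H : hopfAlgebra k) (y x : H).
Hypothesis (H_is_Hn : is_Hn n m t N zeta y x).
Variables (A : algType k) (act : H -> A -> A).
Hypothesis act_ma : module_algebra act.

Let n_gt0 := prim_order_gt0 zeta_prim.

Let act_bil a b : is_bilinear (fun h1 h2 => act h1 a * act h2 b).
Proof.
split=> [h c h1 h2|h c h1 h2] /=.
  by rewrite ((act_bilinear act_ma).1 a) mulrDl -scalerAl.
by rewrite ((act_bilinear act_ma).1 b) mulrDr -scalerAr.
Qed.

Lemma act_linear h : linear (act h).
Proof. exact: (act_bilinear act_ma).2. Qed.

Lemma actZ h c a : act h (c *: a) = c *: act h a.
Proof. by rewrite (scalable_linear (@act_linear h)). Qed.

Lemma act0 h : act h 0 = 0.
Proof. by rewrite -(scale0r 0) actZ !scale0r. Qed.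

Lemma act_sum h I (r : seq I) P F :
  act h (\sum_(i <- r | P i) F i) = \sum_(i <- r | P i) act h (F i).
Proof.
elim/big_rec2: _ => [|i a b _ <-]; first exact: act0.
by rewrite -[F i]scale1r act_linear !scale1r.
Qed.

Lemma act_Zl c h a : act (c *: h) a = c *: act h a.
Proof. by rewrite (scalable_linear ((act_bilinear act_ma).1 a)). Qed.

Lemma act_0l a : act 0 a = 0.
Proof. by rewrite -(scale0r 0) act_Zl !scale0r. Qed.

Lemma act_grouplike g a b : grouplike g -> act g (a * b) = act g a * act g b.
Proof. by move=> [_ dg]; rewrite (Defs.actM act_ma) dg tsum_pure. Qed.

Lemma act_skew g h a b : skew_primitive g 1 h ->
  act h (a * b) = act g a * act h b + act h a * b.
Proof.
move=> dh; rewrite (Defs.actM act_ma) dh [LHS](tsumD _ _ (act_bil a b)).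
by rewrite !tsum_pure // (act_one act_ma).
Qed.

Variable u : A.
Hypothesis yu : act y u = zeta *: u.

Lemma act_yXu i : act y (u ^+ i) = zeta ^+ i *: u ^+ i.
Proof.
elim: i => [|i IHi].
  rewrite (Defs.act1 act_ma) (grouplike_counit (Hn_grouplike H_is_Hn)).
  by rewrite scale1r.
rewrite !exprS (act_grouplike _ _ (Hn_grouplike H_is_Hn)) yu IHi.
by rewrite -scalerAl -scalerAr scalerA.
Qed.

Lemma act_yXXu j i : act (y ^+ j) (u ^+ i) = zeta ^+ (j * i) *: u ^+ i.
Proof.
elim: j => [|j IHj]; first by rewrite (act_one act_ma) scale1r.
by rewrite exprS (act_mul act_ma) IHj actZ act_yXu scalerA mulSn addnC exprD.
Qed.

(** The relation [y * x = zeta ^+ t *: (x * y)] makes [act x u] an eigenvector of [y] for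
    [zeta ^+ (t + 1)]. The eigenvalues [zeta ^+ i] with [i < n] are distinct, so only the
    coefficient at [t + 1] modulo [n] survives. *)
Lemma act_xu_eigen : cyclic_generator n u ->
  exists gamma, act x u = gamma *: u ^+ (t + 1).
Proof.
move=> u_gen; have [c xuE] := cyclic_generator_span n_gt0 u_gen (act x u).
have : act y (act x u) = zeta ^+ (t + 1) *: act x u.
  rewrite -(act_mul act_ma) (Hn_yx H_is_Hn) act_Zl (act_mul act_ma) yu actZ.
  by rewrite scalerA addn1 exprSr.
rewrite xuE act_sum scaler_sumr => /eqP; rewrite -subr_eq0 -sumrB => /eqP.
under eq_bigr do rewrite actZ act_yXu !scalerA -scalerBl.
move=> sum0; pose d i := c i * zeta ^+ i - zeta ^+ (t + 1) * c i.
have d0 := cyclic_generator_free n_gt0 u_gen (c := d) sum0.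
have lt_i0 := ltn_pmod (t + 1) n_gt0.
exists (c ((t + 1) %% n)%N); rewrite (bigD1 (Ordinal lt_i0)) //= big1 => [|i i_neq].
  by rewrite addr0 (expr_mod _ (cyclic_generator_expn u_gen)).
have /eqP := d0 i (ltn_ord i); rewrite /d [_ * c i]mulrC -mulrBr mulf_eq0.
case/orP => [/eqP->|]; first by rewrite scale0r.
rewrite subr_eq0 (eq_prim_root_expr zeta_prim) => /eqP ei.
by case/eqP: i_neq; apply: val_inj; rewrite /= -ei modn_small.
Qed.

Variable gamma : k.
Hypothesis xu : act x u = gamma *: u ^+ (t + 1).

(** The skew Leibniz rule on [u ^+ i * u] adds the summand [zeta ^+ (m * i)]; the sum is a
    [q]-integer for [q = zeta ^+ m]. *)
Lemma act_xXu i :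
  act x (u ^+ i) = (gamma * \sum_(l < i) zeta ^+ (m * l)) *: u ^+ (i + t).
Proof.
elim: i => [|i IHi].
  rewrite (Defs.act1 act_ma) (skew_primitive_counit (Hn_grouplikeX zeta_prim H_is_Hn m)
    (Hn_skew H_is_Hn)).
  by rewrite big_ord0 mulr0 !scale0r.
rewrite exprSr (act_skew _ _ (Hn_skew H_is_Hn)) IHi act_yXXu xu big_ord_recr /=.
rewrite -!scalerAl -scalerAr scalerA -exprD -exprSr addn1 addnS addSn.
by rewrite -scalerDl addrC mulrDr [gamma * zeta ^+ _]mulrC.
Qed.

(** Here [d] is [gamma ^+ j]; only its being nonzero is needed later. *)
Lemma act_xXXu j : exists d,
  act (x ^+ j) u =
  (d * \prod_(l < j) \sum_(i < 1 + t * l) zeta ^+ (m * i)) *: u ^+ (1 + t * j)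
  /\ (gamma != 0 -> d != 0).
Proof.
elim: j => [|j [d [IHj d0]]].
  exists 1; rewrite big_ord0 (act_one act_ma) muln0 mulr1 scale1r.
  by split=> // _; apply: oner_neq0.
exists (d * gamma); split; last by move=> g0; rewrite mulf_neq0 // d0.
rewrite exprS (act_mul act_ma) IHj actZ act_xXu scalerA.
rewrite [\prod_(l < j.+1) _]big_ord_recr /=.
by rewrite mulrACA mulnS addnA [(1 + t + _)%N]addnAC.
Qed.

Lemma Hn_act_coprime : cyclic_generator n u -> gamma != 0 ->
  (m %| n)%N -> coprime t (n %/ m).
Proof.
move=> u_gen gamma0 m_dvd_n.
have [d [/eqP + /(_ gamma0) d0]] := act_xXXu N.
rewrite (Hn_xN H_is_Hn) act_0l eq_sym scaler_eq0.
rewrite (negPf (cyclic_generator_exp_neq0 n_gt0 u_gen _)) orbF mulf_eq0 (negPf d0) /=.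
case/prodf_eq0 => l _ /eqP sum0.
(* Multiplying the vanishing [q]-integer by [q - 1] gives [q ^+ (1 + t * l) = 1]. Hence [n %/ m]
   divides [1 + t * l], and a common divisor with [t] divides [1]. *)
have : zeta ^+ (m * (1 + t * l)) == 1.
  rewrite exprM -subr_eq0 subrX1 (eq_bigr (fun i : 'I_(1 + t * l) => zeta ^+ (m * i))).
    by rewrite sum0 mulr0.
  by move=> i _; rewrite exprM.
rewrite -(prim_order_dvd zeta_prim) -{1}(divnK m_dvd_n) mulnC.
rewrite dvdn_pmul2l; last exact: dvdn_gt0 m_dvd_n.
move=> /dvdnP[s e]; rewrite /coprime -dvdn1.
rewrite -(@dvdn_addl (t * l)); first by rewrite e dvdn_mull ?dvdn_gcdr.
by rewrite dvdn_mulr ?dvdn_gcdl.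
Qed.

Lemma Hn_act_gamma_neq0 : inner_faithful act -> (1 < N)%N ->
  cyclic_generator n u -> gamma != 0.
Proof.
move=> act_if N_gt1 u_gen; apply/eqP => gamma0.
have x_in : exists2 h, xideal x h & h != 0.
  by exists x; [exists 1; rewrite mul1r|exact: (Hn_x_neq0 zeta_prim H_is_Hn N_gt1)].
have [_ [a [[h ->] /eqP[]]]] :=
  act_if _ (hopf_ideal_xideal zeta_prim N_ord H_is_Hn) x_in.
rewrite (act_mul act_ma); have [c ->] := cyclic_generator_span n_gt0 u_gen a.
rewrite act_sum big1 ?act0 // => i _.
by rewrite actZ act_xXu gamma0 mul0r scale0r scaler0.
Qed.

End HnAction.

(** The group [G] is generated by the element [g0] matching [y]. The character taking [y] to [zeta]
    is [Phi] of some [g0 ^ r], so by bimultiplicativity [y] scales [e (g0 ^ r)] by [zeta]; this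
    element is the generator [u]. *)
Lemma is_AH_generator (k : fieldType) n m t N (zeta : k) (H : hopfAlgebra k)
    (y x : H) (A : algType k) (act : H -> A -> A) :
  n.-primitive_root zeta -> N.-primitive_root (zeta ^+ (m * t)) ->
  is_Hn n m t N zeta y x -> is_AH act ->
  exists u, cyclic_generator n u /\ act y u = zeta *: u.
Proof.
move=> zeta_prim N_ord H_is_Hn [act_ma _ [G [iota [e [Phi]]]]].
move=> [_ [iota_inj iota1 iotaM iotaP] [e1 eM e_basis] [Phi_char PhiM Phi_dual] actE].
have n_gt0 := prim_order_gt0 zeta_prim.
have iotaX g i : iota (g ^+ i)%g = iota g ^+ i.
  elim: i => [|i IHi]; first by rewrite expg0 iota1.
  by rewrite expgS iotaM IHi exprS.
have eX g i : e (g ^+ i)%g = e g ^+ i.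
  elim: i => [|i IHi]; first by rewrite expg0 e1.
  by rewrite expgS eM IHi exprS.
have [g0 g0E] := (iotaP y).1 (Hn_grouplike H_is_Hn).
have g0_gen g : exists i, g = (g0 ^+ i)%g.
  have [i gE] := Hn_grouplikeP zeta_prim N_ord H_is_Hn
    ((iotaP (iota g)).2 (ex_intro _ g erefl)).
  by exists i; apply: iota_inj; rewrite iotaX -g0E.
have PhiX1 g h i : Phi g (h ^+ i)%g = Phi g h ^+ i.
  elim: i => [|i IHi]; first by rewrite expg0 (Phi_char g).1.
  by rewrite expgS (Phi_char g).2 IHi exprS.
have Phi1 h : Phi 1%g h = 1.
  have unit_h : Phi 1%g h != 0.
    have := (Phi_char 1%g).2 h h^-1%g; rewrite mulgV (Phi_char _).1 => e11.
    by apply: contra_eq_neq e11 => ->; rewrite mul0r oner_eq0.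
  by apply: (mulfI unit_h); rewrite mulr1 -PhiM mulg1.
have PhiX g h i : Phi (g ^+ i)%g h = Phi g h ^+ i.
  elim: i => [|i IHi]; first by rewrite expg0 Phi1.
  by rewrite expgS PhiM IHi exprS.
have [f [fy _]] := Hn_char zeta_prim N_ord H_is_Hn 1.
have [|g1 [g1E _]] := Phi_dual (fun g => f (iota g)).
  split=> [|g h]; first by rewrite iota1 rmorph1.
  by rewrite iotaM rmorphM.
have [r g1X] := g0_gen g1.
have wr : Phi g0 g0 ^+ r = zeta by rewrite -PhiX -g1X g1E -g0E fy.
have g0n : (g0 ^+ n)%g = 1%g.
  by apply: iota_inj; rewrite iotaX -g0E (Hn_yn H_is_Hn) iota1.
(* Conversely [Phi g0 g0] is a power of [zeta], so [r] is invertible modulo [n] with inverse [s],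
   and [g0 ^ r] again generates [G]. *)
have [s ws] : {s : 'I_n | Phi g0 g0 = zeta ^+ s}.
  by apply: (prim_rootP zeta_prim); rewrite -PhiX g0n Phi1.
have rs1 i : r * s * i = i %[mod n].
  apply/eqP; rewrite -(eq_prim_root_expr zeta_prim) [(r * s)%N]mulnC exprM exprM.
  by rewrite -ws wr.
pose h0 := (g0 ^+ r)%g.
have ew : act y (e h0) = zeta *: e h0 by rewrite {1}g0E actE PhiX1 wr.
have h0_inj (i j : 'I_n) : (h0 ^+ i)%g = (h0 ^+ j)%g -> i = j.
  move=> /(congr1 (fun g => f (iota g))); rewrite /h0 !iotaX -g0E !rmorphXn /= fy.
  rewrite -!exprM => /eqP; rewrite (eq_prim_root_expr zeta_prim) => /eqP eij.
  apply/val_inj; rewrite /= -[LHS](modn_small (ltn_ord i)) -[RHS](modn_small (ltn_ord j)).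
  rewrite -(rs1 i) -(rs1 j) [(r * s)%N]mulnC -!mulnA -modnMmr.
  by rewrite -[in RHS]modnMmr -[(r * i)%N]mul1n -[(r * j)%N]mul1n eij.
have h0_surj g : exists i : 'I_n, (h0 ^+ i)%g == g.
  have [j ->] := g0_gen g; exists (Ordinal (ltn_pmod (s * j) n_gt0)).
  rewrite /= -expgM -(expg_mod (r * _) g0n) -(expg_mod j g0n) modnMmr mulnA rs1.
  by [].
pose inv g := xchoose (h0_surj g).
have invK g : (h0 ^+ inv g)%g = g by apply/eqP; apply: (xchooseP (h0_surj g)).
have h0K (i : 'I_n) : inv (h0 ^+ i)%g = i by apply: h0_inj; rewrite invK.
have sumE (c : G -> k) : \sum_g c g *: e g = \sum_(i < n) c (h0 ^+ i)%g *: e h0 ^+ i.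
  rewrite (reindex (fun i : 'I_n => h0 ^+ i)%g); last first.
    by exists inv => [i _|g _]; [apply: h0K|apply: invK].
  by apply: eq_bigr => i _; rewrite eX.
exists (e h0); split=> //; apply: cyclic_generator_of_basis => // [|a|c sum0 i lt_in].
- by rewrite -eX /h0 -expgM mulnC expgM g0n expg1n.
- have [c [-> _]] := e_basis a; exists (fun i => c (h0 ^+ i)%g); exact: sumE.
(* Freeness follows from the uniqueness of the coordinates of [0]: the given family and the zero
   family must coincide. *)
have [c0 [_ c0_uniq]] := e_basis 0.
have c0E : c0 = [ffun g => c (inv g)].
  apply: c0_uniq; rewrite sumE -[LHS]sum0; apply: eq_bigr => j _.
  by rewrite ffunE h0K.
have : c0 = [ffun=> 0].
  by apply: c0_uniq; rewrite big1 // => g _; rewrite ffunE scale0r.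
rewrite c0E => /ffunP/(_ (h0 ^+ Ordinal lt_in)%g).
by rewrite !ffunE h0K.
Qed.

(** * Construction of [A(H)] *)

Section FunAlgebra.
Variables (k : fieldType) (n : nat).

(** There are [n.+1] points, so that [1] differs from [0]. Given a primitive root of that order,
    interpolation identifies this algebra with polynomials modulo ['X^n.+1 - 1]. *)
Definition fun_alg : Type := {ffun 'I_n.+1 -> k^o}.
HB.instance Definition _ := Vector.copy fun_alg {ffun 'I_n.+1 -> k^o}.
Fact fun_alg_one_neq0 : [ffun=> 1] != 0 :> fun_alg.
Proof. by apply/eqP => /ffunP/(_ ord0)/eqP; rewrite !ffunE oner_eq0. Qed.
HB.instance Definition _ := GRing.Zmodule_isNzRing.Build fun_alg
  (@ffun_mulA _ k^o) (@ffun_mul_1l _ k^o) (@ffun_mul_1r _ k^o)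
  (@ffun_mul_addl _ k^o) (@ffun_mul_addr _ k^o) fun_alg_one_neq0.
HB.instance Definition _ :=
  GRing.PzRing_hasCommutativeMul.Build fun_alg (@ffun_mulC _ k^o).
Fact fun_alg_scalerAl (c : k) (f g : fun_alg) : c *: (f * g) = (c *: f) * g.
Proof. by apply/ffunP => i; rewrite !ffunE scalerAl. Qed.
HB.instance Definition _ := GRing.Lmodule_isLalgebra.Build k fun_alg fun_alg_scalerAl.
HB.instance Definition _ := GRing.Lalgebra_isComAlgebra.Build k fun_alg.

(* The library's algebra of endomorphisms has the product opposite to
   composition. *)
Definition endo : Type := 'End(fun_alg).
HB.instance Definition _ := GRing.Lmodule.copy endo 'End(fun_alg).
Fact endo_one_neq0 : \1%VF != 0 :> endo.
Proof.
apply/eqP => /lfunP/(_ 1); rewrite id_lfunE zero_lfunE => /eqP.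
by rewrite oner_eq0.
Qed.
HB.instance Definition _ := GRing.Zmodule_isNzRing.Build endo
  (@comp_lfunA _ _ _ _ _) (@comp_lfun1l _ _ _) (@comp_lfun1r _ _ _)
  (@comp_lfunDl _ _ _ _) (@comp_lfunDr _ _ _ _) endo_one_neq0.
HB.instance Definition _ := GRing.Lmodule_isLalgebra.Build k endo
  (@comp_lfunZl _ _ _ _).
HB.instance Definition _ := GRing.Lalgebra_isAlgebra.Build k endo
  (@comp_lfunZr _ _ _ _).

Definition endo_fun (f : endo) : fun_alg -> fun_alg := fun_of_lfun f.

Lemma endo_funM (f g : endo) v : endo_fun (f * g) v = endo_fun f (endo_fun g v).
Proof. exact: comp_lfunE. Qed.

End FunAlgebra.

(** In the two parts of the coproduct of [h], terms with left factor in [I] are killed by [phi], and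
    the others leave multiples of elements of [I]. *)
Lemma hopf_ideal_hit (k : fieldType) (H : hopfAlgebra k) (I : H -> Prop)
    (phi : H -> k) h :
  hopf_ideal I -> scalar phi -> (forall g, I g -> phi g = 0) -> I h ->
  I (hit phi h).
Proof.
move=> I_hopf phi_lin phi0 Ih; have hb := hit_bilinear phi_lin.
have [_ [_ [[s [sP ->]] [s' [sP' ->]] hE]]] := hopf_ideal_comul I_hopf Ih.
rewrite /hit hE [X in I X](tsumD _ _ hb) !tsum_sum //.
rewrite big1_seq ?add0r => [|p /sP[Ip _]].
  rewrite big_seq; apply: big_ind => [||p /sP'[_ Ip]].
  - exact: hopf_ideal0.
  - by move=> a b; apply: hopf_idealD.
  - by rewrite tsum_pure // -mulr_algl; apply: hopf_idealMl.
by rewrite tsum_pure // phi0 // scale0r.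
Qed.

(** * The shift, the skew derivation, and the resulting action on functions *)

Section Existence.
Variables (k : fieldType) (n' m t N : nat) (zeta : k).
Notation n := n'.+1.
Hypotheses (zeta_prim : n.-primitive_root zeta)
  (N_ord : N.-primitive_root (zeta ^+ (m * t))).
Notation A := (fun_alg k n').

Definition fun_gen : A := [ffun i : 'I_n => zeta ^+ i].
Local Notation u := fun_gen.

Definition fun_shift (a : A) : A := [ffun i => a (ordS i)].

Fact fun_shift_linear : linear fun_shift.
Proof. by move=> c a b; apply/ffunP => i; rewrite !ffunE. Qed.
HB.instance Definition _ := GRing.isLinear.Build k A A *:%R fun_shift fun_shift_linear.

Definition fun_y : endo k n' := linfun fun_shift.

(** The map [y ^+ m - 1] is a skew derivation, and stays one after multiplication by a fixed
    function, the algebra being commutative. The factor [u ^+ t] shifts weights by [t], as the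
    relation between [y] and [x] requires; here [gamma] is [zeta ^+ m - 1]. *)
Definition fun_skew (a : A) : A := u ^+ t * (endo_fun (fun_y ^+ m) a - a).

Fact fun_skew_linear : linear fun_skew.
Proof.
move=> c a b; rewrite /fun_skew /endo_fun linearP opprD addrACA mulrDr -scalerN.
by rewrite -scalerDr -scalerAr.
Qed.
HB.instance Definition _ := GRing.isLinear.Build k A A *:%R fun_skew fun_skew_linear.

Definition fun_x : endo k n' := linfun fun_skew.

Lemma fun_genX l (i : 'I_n) : (u ^+ l) i = zeta ^+ (i * l).
Proof.
elim: l => [|l IHl]; first by rewrite ffunE muln0.
by rewrite exprS ffunE IHl ffunE -exprD mulnS.
Qed.

Lemma fun_genXn : u ^+ n = 1.
Proof.
apply/ffunP => i; rewrite fun_genX ffunE mulnC exprM.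
by rewrite (prim_expr_order zeta_prim) expr1n.
Qed.

Lemma fun_yE a : endo_fun fun_y a = fun_shift a. Proof. exact: lfunE. Qed.
Lemma fun_xE a : endo_fun fun_x a = fun_skew a. Proof. exact: lfunE. Qed.

Lemma endo_linear (f : endo k n') : linear (endo_fun f).
Proof. exact: linearP. Qed.

Lemma endoZ (f : endo k n') c a : endo_fun f (c *: a) = c *: endo_fun f a.
Proof. exact: linearZ. Qed.

Lemma endo1 a : endo_fun (1 : endo k n') a = a.
Proof. exact: id_lfunE. Qed.

Lemma fun_y_gen l : endo_fun fun_y (u ^+ l) = zeta ^+ l *: u ^+ l.
Proof.
rewrite fun_yE; apply/ffunP => i; rewrite !ffunE !fun_genX /=.
rewrite [_ *: _]mulrC exprM (prim_expr_mod zeta_prim) exprS exprMn.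
by rewrite mulrC exprM.
Qed.

Lemma fun_yX_gen j l : endo_fun (fun_y ^+ j) (u ^+ l) = zeta ^+ (j * l) *: u ^+ l.
Proof.
elim: j => [|j IHj]; first by rewrite endo1 scale1r.
by rewrite exprS endo_funM IHj endoZ fun_y_gen scalerA mulSn addnC exprD.
Qed.

Lemma fun_x_gen l :
  endo_fun fun_x (u ^+ l) = (zeta ^+ (m * l) - 1) *: u ^+ (l + t).
Proof.
rewrite fun_xE /fun_skew fun_yX_gen -[X in _ *: _ - X]scale1r -scalerBl.
by rewrite -scalerAr -exprD addnC.
Qed.

Lemma fun_yM a b : endo_fun fun_y (a * b) = endo_fun fun_y a * endo_fun fun_y b.
Proof. by rewrite !fun_yE; apply/ffunP => i; rewrite !ffunE. Qed.

Lemma fun_yXM j a b : endo_fun (fun_y ^+ j) (a * b) =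
  endo_fun (fun_y ^+ j) a * endo_fun (fun_y ^+ j) b.
Proof.
elim: j => [|j IHj]; first by rewrite !endo1.
by rewrite exprS !endo_funM IHj fun_yM.
Qed.

Lemma fun_xM a b : endo_fun fun_x (a * b) =
  endo_fun (fun_y ^+ m) a * endo_fun fun_x b + endo_fun fun_x a * b.
Proof.
rewrite !fun_xE /fun_skew fun_yXM mulrCA -mulrA -mulrDr; congr (_ * _).
by rewrite mulrBr mulrBl addrA subrK.
Qed.

Lemma fun_y1 : endo_fun fun_y 1 = 1.
Proof. by rewrite -(expr0 u) fun_y_gen scale1r. Qed.

Lemma fun_x1 : endo_fun fun_x 1 = 0.
Proof. by rewrite -(expr0 u) fun_x_gen muln0 subrr scale0r. Qed.

Let V : 'M[k]_n := Vandermonde n (\row_(j < n) zeta ^+ j).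

Let V_unit : V \in unitmx.
Proof.
rewrite unitmxE det_Vandermonde unitfE; apply/prodf_neq0 => i _.
apply/prodf_neq0 => j lt_ij; rewrite !mxE subr_eq0 (eq_prim_root_expr zeta_prim).
by rewrite !modn_small // gtn_eqF.
Qed.

(** The inverse discrete Fourier transform: values at the points become coordinates in the powers of
    [u]. *)
Definition fun_coord (a : A) : 'rV[k]_n := (\row_j a j) *m invmx V.

Lemma fun_coord_linear : linear fun_coord.
Proof.
move=> c a b; rewrite /fun_coord scalemxAl -mulmxDl; congr (_ *m _).
by apply/rowP => j; rewrite !mxE !ffunE.
Qed.

Let rowE (c : 'I_n -> k) : \row_j (\sum_(i < n) c i *: u ^+ i) j = (\row_i c i) *m V.
Proof.
apply/rowP => j; rewrite !mxE sum_ffunE; apply: eq_bigr => i _.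
by rewrite !ffunE fun_genX !mxE exprM.
Qed.

Lemma fun_coordK a : \sum_(i < n) fun_coord a 0 i *: u ^+ i = a.
Proof.
apply/ffunP => j.
have := congr1 (fun r : 'rV_n => r 0 j) (rowE (fun i => fun_coord a 0 i)).
rewrite mxE => ->; suff -> : \row_i fun_coord a 0 i = fun_coord a.
  by rewrite mulmxKV // mxE.
by apply/rowP => i; rewrite mxE.
Qed.

Lemma fun_coord_sum c j : fun_coord (\sum_(i < n) c i *: u ^+ i) 0 j = c j.
Proof. by rewrite /fun_coord rowE mulmxK // mxE. Qed.

Lemma fun_coord_gen l (j : 'I_n) : fun_coord (u ^+ l) 0 j = (j == l %% n :> nat)%N%:R.
Proof.
have lt_ln := ltn_pmod l (ltn0Sn n').
rewrite -(expr_mod l fun_genXn).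
rewrite -[RHS](fun_coord_sum (fun i => (i == (l %% n)%N :> nat)%:R)).
congr (fun_coord _ 0 j); rewrite (bigD1 (Ordinal lt_ln)) //= eqxx scale1r big1 ?addr0 //.
by move=> i /negPf ne; rewrite -val_eqE /= in ne; rewrite ne scale0r.
Qed.

Lemma endo_ext (f g : endo k n') :
  (forall l, endo_fun f (u ^+ l) = endo_fun g (u ^+ l)) -> f = g.
Proof.
move=> e; apply/lfunP => a; rewrite -(fun_coordK a) !linear_sum.
by apply: eq_bigr => i _; rewrite !linearZ; congr (_ *: _); apply: e.
Qed.

Lemma fun_xX_gen j l : endo_fun (fun_x ^+ j) (u ^+ l) =
  (\prod_(i < j) (zeta ^+ (m * (l + t * i)) - 1)) *: u ^+ (l + t * j).
Proof.
elim: j => [|j IHj]; first by rewrite endo1 big_ord0 scale1r muln0 addn0.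
rewrite exprS endo_funM IHj endoZ fun_x_gen scalerA big_ord_recr /=.
by rewrite mulnS -addnA [(_ * j + t)%N]addnC.
Qed.

Lemma fun_Hn_rel : coprime t N -> (m * N = n)%N -> Hn_rel n t N zeta fun_y fun_x.
Proof.
move=> co_tN mN; have N_gt0 := prim_order_gt0 N_ord; split.
- apply: endo_ext => l; rewrite fun_yX_gen exprM (prim_expr_order zeta_prim).
  by rewrite expr1n scale1r endo1.
- apply: endo_ext => l; rewrite fun_xX_gen /endo_fun zero_lfunE.
  (* Some factor of the product giving [x ^ N] on [u ^+ l] must vanish. If [N] divides [1 + a * t],
     then [i = l * a] modulo [N] works, because [l + t * (l * a) = l * (1 + a * t)]. *)
  have [i lt_iN dvd_i] : exists2 i, (i < N)%N & (N %| l + t * i)%N.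
    have [a _] := Bezoutr t N_gt0; rewrite (eqP co_tN) => dvd_a.
    exists ((l * a) %% N)%N; first exact: ltn_pmod.
    rewrite /dvdn -modnDmr modnMmr modnDmr mulnCA [(t * a)%N]mulnC.
    by rewrite -[X in (X + _)%N]muln1 -mulnDr -/(dvdn _ _) dvdn_mull.
  rewrite (bigD1 (Ordinal lt_iN)) //= [X in (X * _) *: _](_ : _ = 0) ?mul0r ?scale0r //.
  apply/eqP; rewrite subr_eq0 -(prim_order_dvd zeta_prim) -mN.
  by rewrite dvdn_mul.
- apply: endo_ext => l; rewrite endo_funM fun_x_gen endoZ fun_y_gen scalerA.
  rewrite /endo_fun scale_lfunE -/(endo_fun _ _) endo_funM fun_y_gen endoZ fun_x_gen.
  by rewrite !scalerA mulrC exprD [zeta ^+ l * _]mulrC.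
Qed.

Variables (H : hopfAlgebra k) (y x : H).
Hypothesis H_is_Hn : is_Hn n m t N zeta y x.
Variable rho : {lrmorphism H -> endo k n'}.
Hypotheses (rho_y : rho y = fun_y) (rho_x : rho x = fun_x).

Definition fun_act (h : H) (a : A) : A := endo_fun (rho h) a.

Lemma fun_act_bilinear : is_bilinear fun_act.
Proof.
split=> [a c h h'|h]; last exact: endo_linear.
by rewrite /fun_act linearP /endo_fun add_lfunE scale_lfunE.
Qed.

Lemma fun_actDl g h a : fun_act (g + h) a = fun_act g a + fun_act h a.
Proof. by rewrite /fun_act linearD /endo_fun add_lfunE. Qed.

Lemma fun_actZl c h a : fun_act (c *: h) a = c *: fun_act h a.
Proof. by rewrite /fun_act linearZ /endo_fun scale_lfunE. Qed.

Lemma fun_actZr c h a : fun_act h (c *: a) = c *: fun_act h a.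
Proof. exact: endoZ. Qed.

Lemma fun_act_mul g h a : fun_act (g * h) a = fun_act g (fun_act h a).
Proof. by rewrite /fun_act rmorphM endo_funM. Qed.

Lemma fun_act1 a : fun_act 1 a = a.
Proof. by rewrite /fun_act rmorph1 endo1. Qed.

Lemma fun_act_y l : fun_act y (u ^+ l) = zeta ^+ l *: u ^+ l.
Proof. by rewrite /fun_act rho_y fun_y_gen. Qed.

Lemma fun_act_x l : fun_act x (u ^+ l) = (zeta ^+ (m * l) - 1) *: u ^+ (l + t).
Proof. by rewrite /fun_act rho_x fun_x_gen. Qed.

Let act_bil a b : is_bilinear (fun h1 h2 => fun_act h1 a * fun_act h2 b).
Proof.
split=> [h c h1 h2|h c h1 h2] /=.
  by rewrite (fun_act_bilinear.1 a) mulrDl -scalerAl.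
by rewrite (fun_act_bilinear.1 b) mulrDr -scalerAr.
Qed.

(** The product and unit axioms are both stable under linear combinations and products in [H], so
    checking them on [y] and [x] suffices. *)
Lemma fun_act_module_algebra : module_algebra fun_act.
Proof.
split.
- exact: fun_act_bilinear.
- by move=> a; rewrite /fun_act rmorph1 endo1.
- exact: fun_act_mul.
- apply: (Hn_gen H_is_Hn (S := fun h => forall a b, fun_act h (a * b) =
    \tsum_(h1, h2 <- comul h) (fun_act h1 a * fun_act h2 b))).
  + by move=> a b; rewrite comul1 tsum_pure // /fun_act rmorph1 !endo1.
  + move=> g h IHg IHh a b; rewrite linearD [RHS](tsumD _ _ (act_bil a b)).
    by rewrite -IHg -IHh fun_actDl.
  + move=> c h IHh a b; rewrite linearZ [RHS](tsumZ _ _ (act_bil a b)) -IHh.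
    by rewrite fun_actZl.
  + move=> g h IHg IHh a b; rewrite fun_act_mul IHh comulM tsum_mul // tsum_exchange.
    rewrite /fun_act /endo_fun {1}/tsum /fsum linear_sum; apply: eq_bigr => p _ /=.
    rewrite -/(endo_fun _ _) -/(fun_act _ _) IHg; apply: eq_tsum => g1 g2.
    by rewrite -!fun_act_mul.
  + move=> a b; have [_ ->] := Hn_grouplike H_is_Hn.
    by rewrite tsum_pure // /fun_act rho_y fun_yM.
  + move=> a b; rewrite (Hn_skew H_is_Hn) [RHS](tsumD _ _ (act_bil a b)) !tsum_pure //.
    by rewrite /fun_act rmorph1 rmorphXn /= rho_y rho_x endo1 fun_xM.
- have y_gl := Hn_grouplike H_is_Hn.
  have yX_gl := Hn_grouplikeX zeta_prim H_is_Hn m.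
  apply: (Hn_gen H_is_Hn (S := fun h => fun_act h 1 = (counit h)%:A)).
  + by rewrite /fun_act !rmorph1 endo1 scale1r.
  + move=> g h IHg IHh; rewrite fun_actDl IHg IHh.
    by rewrite linearD scalerDl.
  + move=> c h IHh; rewrite fun_actZl IHh.
    by rewrite [counit (c *: h)]linearZ scalerA.
  + move=> g h IHg IHh; rewrite fun_act_mul IHh.
    by rewrite fun_actZr [X in _ *: X]IHg rmorphM /= mulrC scalerA.
  + by rewrite /fun_act rho_y fun_y1 (grouplike_counit y_gl) scale1r.
  + rewrite /fun_act rho_x fun_x1.
    by rewrite (skew_primitive_counit yX_gl (Hn_skew H_is_Hn)) scale0r.
Qed.

Lemma fun_gen_exp_neq0 l : u ^+ l != 0.
Proof.
apply/eqP => /ffunP/(_ ord0); rewrite fun_genX ffunE => /eqP.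
by rewrite oner_eq0.
Qed.

Lemma fun_act_poly p l : fun_act (horner_alg y p) (u ^+ l) = p.[zeta ^+ l] *: u ^+ l.
Proof.
elim/poly_ind: p => [|p c IHp].
  by rewrite rmorph0 horner0 scale0r /fun_act rmorph0 [LHS]zero_lfunE.
rewrite rmorphD rmorphM /= horner_algX horner_algC hornerMXaddC.
rewrite fun_actDl fun_actZl fun_act1 fun_act_mul fun_act_y fun_actZr IHp.
by rewrite scalerA -scalerDl mulrC.
Qed.

(* The functional "coefficient of u ^ (t N)" of [h . u ^ t] detects, among the
   monomials [p(y) x ^ j] with [j < N], only those with [j = N - 1]. *)
Lemma fun_act_inner_faithful : inner_faithful fun_act.
Proof.
move=> I I_hopf [h Ih h_neq0]; apply: contrapT => noact.
have act0 g a : I g -> fun_act g a = 0.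
  by move=> Ig; apply/eqP; apply: contrapT => /negP ga; apply: noact; exists g, a.
have N_gt0 := prim_order_gt0 N_ord.
(* Raising to the power [m] would give [(zeta ^+ (m * t)) ^+ i.+1 = 1] with [i.+1 < N]. *)
have zeta_lt i : (i.+1 < N)%N -> zeta ^+ (t * i.+1) != zeta ^+ (t * N).
  move=> lt_iN; apply/eqP => /(congr1 (fun z => z ^+ m)); rewrite -!exprM.
  rewrite ![(t * _ * m)%N]mulnC ![(m * (t * _))%N]mulnA [zeta ^+ (_ * i.+1)]exprM.
  rewrite [RHS]exprM (prim_expr_order N_ord) => /eqP.
  rewrite -(prim_order_dvd N_ord) => /dvdn_leq => /(_ isT).
  by rewrite leqNgt lt_iN.
pose L : 'I_n := Ordinal (ltn_pmod (t * N) (ltn0Sn n')).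
pose phi i g := fun_coord (fun_act g (u ^+ (t * i.+1))) 0 L.
have phi_lin i : scalar (phi i).
  by move=> c a b; rewrite /phi (fun_act_bilinear.1 (u ^+ _)) fun_coord_linear !mxE.
have coordZ c a : fun_coord (c *: a) 0 L = c * fun_coord a 0 L.
  by rewrite (scalable_linear fun_coord_linear) mxE.
have phi_y i g : phi i (g * y) = zeta ^+ (t * i.+1) * phi i g.
  rewrite /phi fun_act_mul fun_act_y fun_actZr.
  by rewrite coordZ.
have phi_x i g : phi i (g * x) = (zeta ^+ (m * (t * i.+1)) - 1) * phi i.+1 g.
  rewrite /phi fun_act_mul fun_act_x fun_actZr.
  by rewrite coordZ -mulnSr.
have phi1 i : phi i 1 = (zeta ^+ (t * i.+1) == zeta ^+ (t * N))%:R.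
  rewrite /phi fun_act1 fun_coord_gen (eq_prim_root_expr zeta_prim).
  by rewrite eq_sym.
have [p hE] := Hn_expand zeta_prim N_ord H_is_Hn h.
have ex_j : exists j, (j < N)%N && (horner_alg y (p j) != 0).
  apply: contrapT => no_j; case/eqP: h_neq0; rewrite hE big1 // => j _.
  have [->|p_j] := eqVneq (horner_alg y (p j)) 0; first by rewrite mul0r.
  by case: no_j; exists j; rewrite ltn_ord.
case: (ex_minnP ex_j) => j /andP[lt_jN p_j] j_min.
(* With [j] the lowest degree present in [h], multiplying by [x ^+ (N.-1 - j)] pushes every higher
   term to a power of [x] at least [N]. *)
have I_top : I (horner_alg y (p j) * x ^+ N.-1).
  have -> : horner_alg y (p j) * x ^+ N.-1 = h * x ^+ (N.-1 - j).
    rewrite hE mulr_suml (bigD1 (Ordinal lt_jN)) //= big1 => [|i i_neq].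
      by rewrite addr0 -mulrA -exprD subnKC // -ltnS prednK.
    have [lt_ij|le_ji] := ltnP i j.
      have [->|p_i] := eqVneq (horner_alg y (p i)) 0; first by rewrite !mul0r.
      by have := j_min i; rewrite ltn_ord p_i => /(_ isT); rewrite leqNgt lt_ij.
    have lt_ji : (j < i)%N by rewrite ltn_neqAle le_ji andbT eq_sym.
    rewrite -mulrA -exprD (_ : i + (N.-1 - j) = N + (i - j.+1))%N; last first.
      rewrite -{1}(subnKC lt_ji) addnAC; congr (_ + _)%N.
      by rewrite addSn subnKC ?prednK // -ltnS prednK.
    by rewrite exprD (Hn_xN H_is_Hn) mul0r mulr0.
  exact: hopf_idealMr.
have := hopf_ideal_hit I_hopf (phi_lin 0) _ I_top.
rewrite (hit_monomial (Hn_grouplike H_is_Hn) (Hn_skew H_is_Hn)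
  phi_lin phi_y phi_x);
  last first.
  by move=> i lt_i; rewrite phi1 (negPf (zeta_lt _ _)) // -ltn_predRL.
rewrite phi1 prednK // eqxx mulr1 horner_alg_scale.
set c := \prod_(i < _) _; set q := _ \Po _ => Iq.
have c_neq0 : c != 0.
  apply/prodf_neq0 => i _; rewrite subr_eq0 mulnA exprM -(prim_order_dvd N_ord).
  apply/negP => /dvdn_leq => /(_ isT); rewrite leqNgt add0n.
  by rewrite -ltn_predRL ltn_ord.
(* The element [c *: q] evaluated at [y] lies in [I], hence kills [u ^+ l], on which it acts by the
   scalar [c * q.[zeta ^+ l]]. *)
have q0 l : q.[zeta ^+ l] = 0.
  apply/eqP; have := fun_act_poly (c *: q) l; rewrite linearZ /= mulr_algl act0.
    move/esym/eqP; rewrite scaler_eq0 (negPf (fun_gen_exp_neq0 l)) orbF hornerZ.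
    by rewrite mulf_eq0 (negPf c_neq0).
  by apply: Iq => g Ig; rewrite /phi act0 // -(scale0r 0) coordZ mul0r.
case/eqP: p_j; apply: (Hn_horner_eq0 zeta_prim H_is_Hn) => i.
(* As [n'] is [-1] modulo [n], this exponent undoes the rescaling of the variable by
   [zeta ^+ (t * N)] in [q]. *)
have := q0 (i + n' * (t * N))%N; rewrite horner_comp hornerZ hornerX.
rewrite -exprD addnCA -mulSn addnC exprD exprM.
by rewrite (prim_expr_order zeta_prim) expr1n mul1r => /eqP.
Qed.

Lemma fun_act_is_AH : is_AH fun_act.
Proof.
split; [exact: fun_act_module_algebra|exact: fun_act_inner_faithful|].
exists 'I_n, (fun g : 'I_n => y ^+ g), (fun g : 'I_n => u ^+ g).
exists (fun g h : 'I_n => zeta ^+ (g * h)).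
have zeta_modr a b : zeta ^+ (a * (b %% n)%N) = zeta ^+ (a * b).
  by apply/eqP; rewrite (eq_prim_root_expr zeta_prim) modnMmr.
split.
- exact: FinRing.zmod_abelian.
- split=> [g h gh|||a].
  + have [f [fy _]] := Hn_char zeta_prim N_ord H_is_Hn 1.
    have := congr1 f gh; rewrite !rmorphXn /= fy => /eqP.
    rewrite (eq_prim_root_expr zeta_prim) !modn_small // => /eqP.
    exact: val_inj.
  + by rewrite expr0.
  + by move=> g h; rewrite -exprD -[RHS](expr_mod _ (Hn_yn H_is_Hn)).
  + split=> [/(Hn_grouplikeP zeta_prim N_ord H_is_Hn) //|[g ->]].
    exact: (Hn_grouplikeX zeta_prim H_is_Hn).
- split=> [||a].
  + by rewrite expr0.
  + by move=> g h; rewrite -exprD -[RHS](expr_mod _ fun_genXn).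
  + exists [ffun i => fun_coord a 0 i]; split=> [|c aE].
      by rewrite -[LHS]fun_coordK; apply: eq_bigr => i _; rewrite ffunE.
    by apply/ffunP => i; rewrite ffunE aE fun_coord_sum.
- split=> [g|g g' h|chi [chi1 chiM]].
  + split=> [|h h']; first by rewrite muln0.
    by rewrite -exprD -mulnDr zeta_modr.
  + by rewrite -exprD -mulnDl mulnC zeta_modr mulnC.
  (* A character is determined by its value at the generator [1], an [n]-th root of unity and thus a
     unique power of [zeta]. *)
  + pose g1 : 'I_n := Zp1.
    have g1X (i : 'I_n) : i = (g1 ^+ i)%g by rewrite Zp1_expgz.
    have chiX i : chi (g1 ^+ i)%g = chi g1 ^+ i.
      elim: i => [|i IHi]; first by rewrite expg0 chi1.
      by rewrite expgS chiM IHi exprS.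
    have [g gE] : {g : 'I_n | chi g1 = zeta ^+ g}.
      apply: (prim_rootP zeta_prim); rewrite -chiX -chi1.
      by congr chi; rewrite /g1 Zp_expg; apply/val_inj; rewrite /= modnMl.
    exists g; split=> [h|g' g'E].
      by rewrite [in RHS](g1X h) chiX gE exprM.
    apply/val_inj/eqP; have /eqP := g'E g1; rewrite zeta_modr muln1 gE.
    by rewrite (eq_prim_root_expr zeta_prim) eq_sym !modn_small.
- by move=> g h; rewrite /fun_act rmorphXn /= rho_y fun_yX_gen.
Qed.

End Existence.

(** * Arithmetic of the conditions, and the conclusion *)

Lemma prim_root_order_inj (F : fieldType) (z : F) a b :
  a.-primitive_root z -> b.-primitive_root z -> a = b.
Proof.
move=> za zb; apply/eqP; rewrite eqn_dvd.
by rewrite (prim_order_dvd za) (prim_order_dvd zb) !prim_expr_order ?eqxx.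
Qed.

Theorem proposition4p17 (k : closedFieldType) (k_char0 : [pchar k] =i pred0)
    (n m t N : nat) (n_gt0 : (0 < n)%N)
    (m_gt0 : (0 < m)%N) (t_gt0 : (0 < t)%N)
    (m_dvd_n : (m %| n)%N) (t_dvd_n : (t %| n)%N)
    (n_ndvd_mt : ~~ (n %| m * t)%N)
    (zeta : k) (zeta_prim : n.-primitive_root zeta)
    (N_ord : N.-primitive_root (zeta ^+ (m * t)))
    (H : hopfAlgebra k) (y x : H) (H_is_Hn : is_Hn n m t N zeta y x) :
  [/\ (* conditions (a), (b), (c) are equivalent *)
      (gcdn t (n %/ m) = 1%N <-> gcdn (m * t) n = m) /\
      (gcdn (m * t) n = m <-> (n %/ m)%N = N),
      (* existence of A(H) is equivalent to them *)
      (exists (A : algType k) (act : H -> A -> A), is_AH act) <->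
        gcdn t (n %/ m) = 1%N,
      t = 1%N -> exists (A : algType k) (act : H -> A -> A), is_AH act
    & (* constraints on any A(H) *)
      forall (A : algType k) (act : H -> A -> A), is_AH act ->
        [/\ (t %| m)%N,
            exists u : A, cyclic_generator n u /\ act y u = zeta *: u
          & forall u : A, cyclic_generator n u -> act y u = zeta *: u ->
              exists2 gamma : k, gamma != 0 & act x u = gamma *: u ^+ (t + 1)]].
Proof.
have mn : (m * (n %/ m))%N = n by rewrite mulnC divnK.
have gcdE : gcdn (m * t) n = (m * gcdn t (n %/ m))%N.
  by rewrite -{1}mn muln_gcdr.
(* Orders are unique, and a power of a primitive root has this order; conditions (b) and (c) become
   the same equation. *)
have NE : N = (n %/ gcdn (m * t) n)%N.
  exact: prim_root_order_inj N_ord (exp_prim_root zeta_prim _).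
have N_gt1 : (1 < N)%N.
  rewrite ltn_neqAle (prim_order_gt0 N_ord) andbT; apply: contra n_ndvd_mt => /eqP N1.
  by rewrite (prim_order_dvd zeta_prim) -[_ ^+ _]expr1 N1 prim_expr_order.
have ab : gcdn t (n %/ m) = 1%N <-> gcdn (m * t) n = m.
  rewrite gcdE; split=> [->|/eqP]; first exact: muln1.
  by rewrite -[X in _ == X]muln1 eqn_pmul2l // => /eqP.
have bc : gcdn (m * t) n = m <-> (n %/ m)%N = N.
  split=> [e|e]; first by rewrite NE e.
  apply/eqP; rewrite -(eqn_pmul2r (prim_order_gt0 N_ord)) -{2}e mn NE.
  by rewrite mulnC divnK ?dvdn_gcdr.
have exists_AH : gcdn t (n %/ m) = 1%N ->
    exists (A : algType k) (act : H -> A -> A), is_AH act.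
  move=> co; have nmN : (n %/ m)%N = N by apply/bc/ab.
  rewrite nmN in co mn; have co_tN : coprime t N by apply/eqP.
  have [n' nE] : exists n', n = n'.+1 by exists n.-1; rewrite prednK.
  rewrite nE in zeta_prim H_is_Hn mn; have [rho [rho_y rho_x]] :=
    Hn_univ H_is_Hn (fun_Hn_rel zeta_prim N_ord co_tN mn).
  exists (fun_alg k n'), (fun_act rho).
  exact: (fun_act_is_AH zeta_prim N_ord H_is_Hn rho_y rho_x).
have AH_generator (A : algType k) (act : H -> A -> A) : is_AH act ->
    exists u : A, cyclic_generator n u /\ act y u = zeta *: u.
  exact: is_AH_generator zeta_prim N_ord H_is_Hn.
have AH_x (A : algType k) (act : H -> A -> A) (u : A) :
    is_AH act -> cyclic_generator n u ->
    act y u = zeta *: u ->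
    exists2 gamma : k, gamma != 0 & act x u = gamma *: u ^+ (t + 1).
  move=> [act_ma act_if _] u_gen yu.
  have [gamma xu] := act_xu_eigen zeta_prim H_is_Hn act_ma yu u_gen.
  exists gamma => //.
  exact: (Hn_act_gamma_neq0 zeta_prim N_ord H_is_Hn act_ma yu xu act_if N_gt1 u_gen).
have AH_coprime (A : algType k) (act : H -> A -> A) :
    is_AH act -> gcdn t (n %/ m) = 1%N.
  move=> AH; have [u [u_gen yu]] := AH_generator A act AH.
  have [gamma gamma_neq0 xu] := AH_x A act u AH u_gen yu; have [act_ma _ _] := AH.
  apply/eqP.
  exact: (Hn_act_coprime zeta_prim H_is_Hn act_ma yu xu u_gen gamma_neq0 m_dvd_n).
split.
- by [].
- by split=> [[A [act /AH_coprime]]|/exists_AH].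
- by move=> t1; apply: exists_AH; rewrite t1 gcd1n.
move=> A act AH; split.
(* As [t] divides [n = m * (n %/ m)] and is coprime to the second factor, it divides [m]. *)
- have /eqP := AH_coprime A act AH; rewrite -/(coprime t _) => /Gauss_dvdl <-.
  by rewrite mn.
- exact: AH_generator.
- by move=> u u_gen yu; apply: AH_x.
Qed.
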